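(* For the model described in the context (depending on the error probability $p\in[0,1/2]$), there exist constants $0<p_\star\le p^\star<1/2$ such that the filter is stable whenever $p^\star<p\le 1/2$ and the filter is not stable whenever $0\le p<p_\star$.
   Context: Model. Fix $p\in[0,1/2]$. Let $(X_k^v)_{k,v\in\mathbb{Z}}$ be i.i.d. random variables with values in $\{-1,1\}$ and $\mathbf{P}[X_k^v=1]=1/2$. Let $(\bar\xi_k^v)_{k,v\in\mathbb{Z}}$ and $(\hat\xi_k^v)_{k,v\in\mathbb{Z}}$ be (jointly) i.i.d. $\{-1,1\}$-valued random variables, equal to $-1$ with probability $p$, and independent of $(X_k^v)_{k,v\in\mathbb{Z}}$. Define $$\bar Y_k^v = X_k^vX_{k-1}^v\bar\xi_k^v,\qquad \hat Y_k^v = X_k^vX_k^{v+1}\hat\xi_k^v .$$ Write $X_k=(X_k^v)_{v\in\mathbb{Z}}\in\{-1,1\}^{\mathbb{Z}}$ and $Y_k=(\bar Y_k^v,\hat Y_k^v)_{v\in\mathbb{Z}}\in(\{-1,1\}\times\{-1,1\})^{\mathbb{Z}}$. Definition. The filter is called stable if $$\mathbf{E}\big|\mathbf{P}[X_k\in A|X_0,Y_1,\ldots,Y_k]-\mathbf{P}[X_k\in A|Y_1,\ldots,Y_k]\big|\to 0\quad\text{as }k\to\infty$$ for every measurable set $A\subseteq\{-1,1\}^{\mathbb{Z}}$ (with the product $\sigma$-field). *)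

(* Defs.v *)
From HB Require Import structures.
From mathcomp Require Import all_boot all_order all_algebra.
From mathcomp Require Import all_classical all_reals all_analysis.
From mathcomp Require Import measurable_realfun.
Set Implicit Arguments.
Unset Strict Implicit.
Unset Printing Implicit Defensive.
Import Order.TTheory GRing.Theory Num.Theory.
Import numFieldNormedType.Exports.
Local Open Scope classical_set_scope.
Local Open Scope ring_scope.

(* The events observable through the single variables F i, i in D;
   sigma(F i, i in D) is <<s gen_events F D >>. *)
Definition gen_events d (T : measurableType d) (R : realType) (I : Type)
    (F : I -> T -> R) (D : set I) : set (set T) :=
  \bigcup_(i in D) preimage_set_system setT (F i) measurable.

Definition mutually_independent d (T : measurableType d) (R : realType)
    (P : probability T R) (I : choiceType) (F : I -> T -> R) : Prop :=
  forall (s : seq I) (B : I -> set R), uniq s ->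
    (forall i, measurable (B i)) ->
    P (\big[setI/setT]_(i <- s) (F i @^-1` B i)) =
    (\prod_(i <- s) P (F i @^-1` B i))%E.

Definition independent_set_systems d (T : measurableType d) (R : realType)
    (P : probability T R) (G H : set (set T)) : Prop :=
  forall A B, G A -> H B -> P (A `&` B) = (P A * P B)%E.

(* f is a version of P[E | G], for G a sub-sigma-algebra of the events. *)
Definition is_cond_prob d (T : measurableType d) (R : realType)
    (P : probability T R) (G : set (set T)) (E : set T) (f : T -> R) : Prop :=
  [/\ forall B : set R, measurable B -> G (f @^-1` B),
      P.-integrable setT (EFin \o f) &
      forall B, G B -> (\int[P]_(w in B) (f w)%:E)%E = P (E `&` B)].

(* Versions exist, by the Radon-Nikodym theorem on the measurable space
   (T, <<s G >>). *)
Lemma is_cond_prob_exists d (T : measurableType d) (R : realType)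
    (P : probability T R) (G : set (set T)) (E : set T) :
  G `<=` measurable -> measurable E -> exists f, is_cond_prob P <<s G >> E f.
Proof.
move=> GT mE.
have sGT : <<s G >> `<=` measurable.
  by apply: smallest_sub => //; exact: sigma_algebra_measurable.
pose T' := g_sigma_algebraType G.
pose i : T -> T' := idfun.
have mi : measurable_fun setT i by move=> _ A mA; rewrite setTI; exact: sGT.
pose X : {RV P >-> T'} := HB.pack i (isMeasurableFun.Build _ _ _ _ i mi).
pose nu : {finite_measure set T -> \bar R} := mrestr P mE.
pose N := pushforward nu i.
pose N1 : {measure set T' -> \bar R} :=
  measure_function_pushforward__canonical__measure_function_Measure nu mi.
have Nfin : fin_num_fun N.
  by move=> A mA; apply: fin_num_measure; exact: sGT.
pose N2f : {finite_measure set T' -> \bar R} :=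
  HB.pack N (Measure.class N1) (Measure_isFinite.Build _ _ _ N1 Nfin).
pose N2 : {finite_measure set T' -> \bar R} := N2f mi.
pose Q : probability T' R := distribution P X.
have dom : N2 `<< Q.
  apply/null_content_dominatesP => A mA QA0.
  apply/eqP; rewrite eq_le measure_ge0 andbT -QA0.
  apply: le_measure; rewrite ?inE; last exact: subIsetl.
  - exact: measurableI (sGT _ mA) mE.
  - exact: sGT.
pose g := Radon_Nikodym_SigmaFinite.f N2 Q.
have gfin x : g x \is a fin_num by exact: Radon_Nikodym_SigmaFinite.f_fin_num.
have gint := Radon_Nikodym_SigmaFinite.f_integrable dom.
have mg := measurable_int Q gint.
have g0 x : (0 <= g x)%E by exact: Radon_Nikodym_SigmaFinite.f_ge0.
have mgT : measurable_fun (@setT T) (g : T -> \bar R).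
  by move=> _ B mB; apply: sGT; exact: mg.
have gE B : measurable (B : set T') -> (\int[P]_(w in B) g w)%E = P (E `&` B).
  move=> mB; have := Radon_Nikodym_SigmaFinite.f_integral dom mB.
  rewrite (ge0_integral_pushforward mi) //; last exact: measurable_funTS.
  by rewrite setIC => <-.
have fE : (EFin \o (fine \o g)) = g by apply/funext => x /=; rewrite fineK.
exists (fine \o g); split.
- move=> B mB.
  have := measurableT_comp (@fine_measurable R setT measurableT) mg.
  by move=> /(_ measurableT B mB); rewrite setTI.
- rewrite fE; apply/integrableP; split => //.
  under eq_integral do rewrite gee0_abs//.
  by rewrite gE // ?setIT -?ge0_fin_numE ?fin_num_measure//; exact: measurableT.
- by move=> B GB; under eq_integral do rewrite fineK//; exact: gE.
Qed.

Definition sign_valued (T : Type) (R : realType) (F : T -> R) : Prop :=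
  forall w, F w = 1 \/ F w = -1.

Definition noise d (T : measurableType d) (R : realType)
    (P : probability T R) (xib xih : int -> int -> {RV P >-> R})
    (i : (int * int) + (int * int)) : T -> R :=
  match i with inl kv => xib kv.1 kv.2 | inr kv => xih kv.1 kv.2 end.

Definition signal d (T : measurableType d) (R : realType)
    (P : probability T R) (X : int -> int -> {RV P >-> R})
    (i : int * int) : T -> R := X i.1 i.2.

(* In all families below the first index is the time k, the second one the
   site v. *)
Definition filter_model d (T : measurableType d) (R : realType)
    (P : probability T R) (p : R)
    (X xib xih : int -> int -> {RV P >-> R}) : Prop :=
  [/\ (forall i, sign_valued (signal X i)) /\
      (forall i, P (signal X i @^-1` [set 1]) = (1 / 2)%:E),
      (forall i, sign_valued (noise xib xih i)) /\
      (forall i, P (noise xib xih i @^-1` [set -1]) = p%:E),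
      mutually_independent P (signal X),
      mutually_independent P (noise xib xih) &
      independent_set_systems P
        <<s gen_events (signal X) setT >>
        <<s gen_events (noise xib xih) setT >>].

Definition Ybar d (T : measurableType d) (R : realType)
    (P : probability T R) (X xib : int -> int -> {RV P >-> R})
    (i : int * int) (w : T) : R :=
  X i.1 i.2 w * X (i.1 - 1) i.2 w * xib i.1 i.2 w.

Definition Yhat d (T : measurableType d) (R : realType)
    (P : probability T R) (X xih : int -> int -> {RV P >-> R})
    (i : int * int) (w : T) : R :=
  X i.1 i.2 w * X i.1 (i.2 + 1) w * xih i.1 i.2 w.

Definition obs_events d (T : measurableType d) (R : realType)
    (P : probability T R) (X xib xih : int -> int -> {RV P >-> R})
    (k : nat) : set (set T) :=
  gen_events (Ybar X xib) [set i | 1 <= i.1 <= k%:Z] `|`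
  gen_events (Yhat X xih) [set i | 1 <= i.1 <= k%:Z].

Definition init_events d (T : measurableType d) (R : realType)
    (P : probability T R) (X : int -> int -> {RV P >-> R}) : set (set T) :=
  gen_events (signal X) [set i | i.1 = 0].

(* {-1,1}^Z, as a subset of R^Z *)
Definition sign_configs (R : realType) : set (int -> R) :=
  [set x | sign_valued x].

(* the product sigma-field on {-1,1}^Z *)
Definition measurable_config (R : realType) (A : set (int -> R)) : Prop :=
  <<s @sign_configs R,
    [set C | exists v s, C = @sign_configs R `&` [set x | x v = s]] >> A.

(* Conditional probabilities are only defined up to null sets, and the
   expectation below does not depend on the versions f k, g k chosen; such
   versions exist by is_cond_prob_exists. *)
Definition filter_stable d (T : measurableType d) (R : realType)
    (P : probability T R) (X xib xih : int -> int -> {RV P >-> R}) : Prop :=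
  forall A : set (int -> R), measurable_config A ->
  forall f g : nat -> T -> R,
    let Xk_in_A k := [set w | A (fun v => X k%:Z v w)] in
    (forall k, is_cond_prob P <<s init_events X `|` obs_events X xib xih k >>
                 (Xk_in_A k) (f k)) ->
    (forall k, is_cond_prob P <<s obs_events X xib xih k >>
                 (Xk_in_A k) (g k)) ->
    'E_P[(fun w => `|f k w - g k w|)%R]%E @[k --> \oo] --> 0%E.

(* Main.v *)
(* A bit x(k, v) is the sign of X_k^v; modulo 2 the observations are the
   coboundary of x plus the noise, so given Y_1, ..., Y_k the signal is a random
   field Ising model with pair interactions on the strip {0, ..., k} x Z, and
   conditioning on X_0 fixes its values at time 0.

   For p close to 1/2 the interaction is weak.  Dobrushin's oscillation argument
   (heat-bath updates of single sites) shows, in every finite box and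
   uniformly in the observations, that the law of finitely many X_k^v depends
   on the boundary condition at time 0 only up to O(2^-k).  Conditional
   probabilities given infinitely many variables are reached by approximating,
   in L^1, the conditional probability given X_0, Y_1, ..., Y_k by a function of
   finitely many variables.

   For p close to 0, the symmetry (X, xi) -> (-X, xi) gives
   P[X_k^0 = 1 | Y_1, ..., Y_k] = 1/2.  Given X_0, the site X_k^0 is recovered with
   high probability by the configuration in the box {0, ..., k} x {0, ..., k+1}
   violating the fewest observations: by Peierls' argument an error
   at the corner (k, 0) forces a trail in the dual lattice that separates
   this corner from time 0 and half of whose edges are noisy. *)

Require Import Defs.
From mathcomp Require Import all_boot all_order all_algebra.
From mathcomp Require Import all_classical all_reals all_analysis.
From mathcomp Require Import measurable_realfun.
From mathcomp Require Import zify ring lra.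
Set Implicit Arguments.
Unset Strict Implicit.
Unset Printing Implicit Defensive.
Import Order.TTheory GRing.Theory Num.Theory.
Import numFieldNormedType.Exports.
Local Open Scope classical_set_scope.
Local Open Scope ring_scope.

(** * Dobrushin decay of correlations *)

(** Conditional probabilities given infinitely many variables are handled through integrals over
    events. Let [u] be a local step function close to the better informed filter [f], [h] the filter
    of a finite box and [g] the filter without X_0. The sets where u <= h and h <= g are events of
    the right sigma-algebras, and integrating over them and their complements bounds L1 distances.
    So only [f] has to be approximated; [h] and [g] follow by contraction. The window of [u] is out
    of control, hence the box estimate must be uniform in the width of the box and only the distance
    k to time 0 may enter: this dictates an oscillation weighted by the level of the site. For weak
    noise the site sits in a corner of the box, so that a separating trail crosses column 0 at one
    of k places. Starting at height j it has at least k - j further edges, so the union bound is a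
    geometric series bounded in k. With p <= (1/128)^2, at least half of s given edges are noisy
    with probability at most 2^s / 128^s, and four directions per step leave a ratio 1/16. *)

Section Dobrushin.
Variables (R : realType) (V : finType).
Notation cfg := {ffun V -> bool}.

Definition flip (v : V) (x : cfg) : cfg := [ffun u => x u (+) (u == v)].

Lemma flipK v : involutive (flip v).
Proof. by move=> x; apply/ffunP => u; rewrite !ffunE -addbA addbb addbF. Qed.

Lemma flipC u v x : flip u (flip v x) = flip v (flip u x).
Proof. by apply/ffunP => t; rewrite !ffunE addbAC. Qed.

Definition osc_le (b : V -> R) (f : cfg -> R) :=
  forall v x, `|f (flip v x) - f x| <= b v.

Lemma osc_total b f x y : (forall v, 0 <= b v) -> osc_le b f ->
  `|f x - f y| <= \sum_v b v.
Proof.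
move=> b0 bf; suff: forall s : seq V, (forall v, v \notin s -> x v = y v) ->
    `|f x - f y| <= \sum_(v <- s) b v.
  by move=> /(_ (index_enum V)); apply => v; rewrite mem_index_enum.
move=> s; elim: s x => [|v s IH] x xy.
  rewrite big_nil; have -> : x = y by apply/ffunP => v; exact: xy.
  by rewrite subrr normr0.
rewrite big_cons; have [xyv|xyv] := eqVneq (x v) (y v).
  rewrite (le_trans (IH x _)) ?lerDr// => u us.
  by have [->//|uv] := eqVneq u v; apply: xy; rewrite inE negb_or uv.
have -> : f x - f y = (f x - f (flip v x)) + (f (flip v x) - f y) by ring.
apply: (le_trans (ler_normD _ _)); apply: lerD; first by rewrite distrC.
apply: IH => u us; rewrite ffunE; have [->|uv] := eqVneq u v.
  by move: xyv; case: (x v); case: (y v).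
by rewrite addbF; apply: xy; rewrite inE negb_or uv.
Qed.

Variables (W : cfg -> R) (c : R) (nb : rel V).
Hypothesis W_gt0 : forall x, 0 < W x.
Hypothesis c_ge0 : 0 <= c.
(** Let r = W x * W (flip u (flip v x)) / (W (flip u x) * W (flip v x)). Then [W_far] says r = 1,
    and [W_near] says |r - 1| / (r + 1) <= c. The left side is |tanh (log r / 2)|, a bound on the
    influence of one site on the heat-bath law of the other; the product form avoids divisions. *)
Hypothesis W_far : forall u v x, u != v -> ~~ nb v u ->
  W x * W (flip u (flip v x)) = W (flip u x) * W (flip v x).
Hypothesis W_near : forall u v x, u != v -> nb v u ->
  `|W x * W (flip u (flip v x)) - W (flip u x) * W (flip v x)| <=
    c * (W x * W (flip u (flip v x)) + W (flip u x) * W (flip v x)).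

Definition heat_bath v (f : cfg -> R) x :=
  (W x * f x + W (flip v x) * f (flip v x)) / (W x + W (flip v x)).

Lemma heat_bath_flip v f x : heat_bath v f (flip v x) = heat_bath v f x.
Proof. by rewrite /heat_bath flipK addrC [in X in _ / X]addrC. Qed.

Lemma heat_bath_sum v f (Q : pred cfg) : (forall x, Q (flip v x) = Q x) ->
  \sum_(x | Q x) W x * heat_bath v f x = \sum_(x | Q x) W x * f x.
Proof.
move=> Qv; set S := LHS; set S' := RHS.
have reind (F : cfg -> R) :
    \sum_(x | Q x) F (flip v x) = \sum_(x | Q x) F x.
  rewrite [RHS](reindex_inj (inv_inj (flipK v)))/=.
  by apply: eq_bigl => x; rewrite Qv.
have S1 : S = \sum_(x | Q x) W (flip v x) * heat_bath v f x.
  rewrite /S -reind; apply: eq_bigr => x _.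
  by rewrite heat_bath_flip.
(* Each sum is added to its image under [flip v], which pairs x with [flip v x]. On such a pair the
   common value of [heat_bath] times the total weight is the original contribution. *)
have : S + S = S' + S'.
  rewrite {2}S1 /S' -{2}(reind (fun x => W x * f x)) /S -!big_split/=.
  apply: eq_bigr => x _; rewrite /heat_bath -mulrDl mulrCA divff ?mulr1//.
  by rewrite gt_eqF ?addr_gt0.
by move=> SS; lra.
Qed.

(** An update forgets the coordinate v, so the oscillation there vanishes. Flipping another site u
    changes the averaged values, by at most [b u], and the averaging weights; the change of weights
    moves the mean by at most c times the oscillation at v, and only when u is a neighbour. *)
Lemma heat_bath_osc v b f : (forall v, 0 <= b v) -> osc_le b f ->
  osc_le (fun u => if u == v then 0 else b u + (if nb v u then c * b v else 0))
    (heat_bath v f).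
Proof.
move=> b0 bf u x; have [->|uv] := eqVneq u v.
  by rewrite heat_bath_flip subrr normr0.
rewrite /heat_bath -(flipC u v).
have := bf u x; have := bf u (flip v x); have := bf v x.
set A := W x; set B := W (flip v x); set A' := W (flip u x).
set B' := W (flip u (flip v x)).
set a := f x; set a' := f (flip u x); set e := f (flip v x).
set e' := f (flip u (flip v x)) => ea e'e a'a.
have [A0 B0 A'0 B'0] : [/\ 0 < A, 0 < B, 0 < A' & 0 < B'] by split; exact: W_gt0.
have AB0 : 0 < A + B by exact: addr_gt0.
have A'B'0 : 0 < A' + B' by exact: addr_gt0.
(* The first term changes the values under the flipped weights; the second changes the weights under
   the unflipped values. *)
have -> : (A' * a' + B' * e') / (A' + B') - (A * a + B * e) / (A + B) =
    (A' * (a' - a) + B' * (e' - e)) / (A' + B') +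
    (a - e) * (A' * B - A * B') / ((A' + B') * (A + B)).
  by field; rewrite !gt_eqF.
apply: (le_trans (ler_normD _ _)); apply: lerD.
  rewrite normrM normfV (gtr0_norm A'B'0) ler_pdivrMr//.
  apply: (le_trans (ler_normD _ _)); rewrite !normrM (gtr0_norm A'0) (gtr0_norm B'0).
  have : A' * `|a' - a| <= A' * b u by rewrite ler_pM2l.
  have : B' * `|e' - e| <= B' * b u by rewrite ler_pM2l.
  by lra.
have K : `|A' * B - A * B'| <= (if nb v u then c else 0) * (A * B' + A' * B).
  have [vu|vu] := boolP (nb v u); first by rewrite distrC; exact: W_near.
  by rewrite /A /B /A' /B' (W_far x uv vu) subrr normr0 mul0r.
rewrite normrM normfV normrM (gtr0_norm (mulr_gt0 A'B'0 AB0)).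
rewrite ler_pdivrMr ?mulr_gt0//.
have -> : (if nb v u then c * b v else 0) = b v * (if nb v u then c else 0).
  by case: ifP => _; rewrite ?mulr0// mulrC.
rewrite -mulrA; apply: ler_pM => //; first by rewrite distrC.
apply: (le_trans K); apply: ler_wpM2l; first by case: ifP.
have : 0 < A * A' by exact: mulr_gt0.
have : 0 < B * B' by exact: mulr_gt0.
by lra.
Qed.

Variables (rho : V -> R) (Bd : pred V).
Hypothesis rho_ge1 : forall v, 1 <= rho v.
Hypothesis rho_nb : forall v, ~~ Bd v ->
  \sum_(u | nb v u) c * rho u <= rho v / 2.

Definition bd_event (Q : pred cfg) :=
  forall v x, ~~ Bd v -> Q (flip v x) = Q x.

(** Updates at inner sites preserve all integrals over boundary events. Hence f may be replaced by a
    function of smaller oscillation without changing any mean given the boundary. *)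
Definition same_means (f g : cfg -> R) := forall Q, bd_event Q ->
  \sum_(x | Q x) W x * f x = \sum_(x | Q x) W x * g x.

Local Notation mass b := (\sum_v rho v * b v).
Local Notation inner b := (\sum_(v | ~~ Bd v) rho v * b v).

(** Updating an inner site v removes [rho v * b v] from the weighted oscillation and, by [rho_nb],
    puts at most half of it back on the neighbours. Choosing v with [rho v * b v] maximal makes the
    loss a fixed fraction of the inner mass. *)
Lemma dobrushin_step b f : (forall v, 0 <= b v) -> osc_le b f ->
  exists b' f', [/\ forall v, 0 <= b' v, osc_le b' f', same_means f' f,
    mass b' <= mass b &
    inner b' <= (1 - (2 * #|V|.+1%:R)^-1) * inner b].
Proof.
move=> b0 bf.
have rho0 v : 0 <= rho v by rewrite (le_trans ler01).
have [v0 v0B|noB] := pickP (fun v => ~~ Bd v); last first.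
  exists b, f; split => //; rewrite !big_pred0 ?mulr0// => v; exact: noB.
have [v vB vmax] := @arg_maxP _ _ _ v0 (fun v => ~~ Bd v)
  (fun v => rho v * b v) v0B.
set N : R := #|V|.+1%:R; have N0 : 0 < N by rewrite ltr0n.
have innerN : inner b <= N * (rho v * b v).
  apply: (@le_trans _ _ (\sum_(u | ~~ Bd u) rho v * b v)).
    by apply: ler_sum => u; exact: vmax.
  rewrite sumr_const -mulr_natl ler_wpM2r ?mulr_ge0//.
  by rewrite ler_nat ltnW// ltnS max_card.
set b' := fun u => if u == v then 0 else b u + (if nb v u then c * b v else 0).
(* Used for all sites, where it gives the monotonicity of the mass, and for the inner sites, where
   it gives the decay. *)
have key (P : pred V) : P v -> \sum_(u | P u) rho u * b' u <=
    \sum_(u | P u) rho u * b u - rho v * b v / 2.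
  move=> Pv; rewrite (bigD1 v)//= [X in _ <= X - _](bigD1 v)//=.
  rewrite {1}/b' eqxx mulr0 add0r.
  have : \sum_(u | P u && (u != v)) rho u * b' u <=
         \sum_(u | P u && (u != v)) rho u * b u +
         \sum_(u | nb v u) c * rho u * b v.
    rewrite [X in _ <= _ + X]big_mkcond/=.
    apply: (@le_trans _ _ (\sum_(u | P u && (u != v)) rho u * b u +
       \sum_(u | P u && (u != v)) (if nb v u then c * rho u * b v else 0))).
      rewrite -big_split/=; apply: ler_sum => u /andP[_ uv].
      rewrite /b' (negbTE uv); case: ifP => _; last by rewrite !addr0.
      by rewrite mulrDr lerD2l mulrA (mulrC (rho u)).
    rewrite lerD2l [leRHS](bigID (fun u => P u && (u != v)))/= lerDl.
    by apply: sumr_ge0 => u _; case: ifP => // _; rewrite !mulr_ge0.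
  rewrite -mulr_suml; have := rho_nb vB => H1.
  have : (\sum_(u | nb v u) c * rho u) * b v <= rho v / 2 * b v.
    exact: ler_wpM2r.
  by set X1 := \sum_(_ | _) _; set X2 := \sum_(_ | _) _; set X3 := _ * b v; lra.
have rv0 : 0 <= rho v * b v by exact: mulr_ge0.
exists b', (heat_bath v f); split.
- move=> u; rewrite /b'; case: ifP => // _; apply: addr_ge0 => //.
  by case: ifP => // _; exact: mulr_ge0.
- exact: heat_bath_osc.
- by move=> Q Qbd; apply: heat_bath_sum => x; exact: Qbd.
- by have := key xpredT isT => /=; lra.
- have := key (fun v => ~~ Bd v) vB; rewrite /= mulrBl mul1r invfM -(mulrA 2^-1).
  have : N^-1 * inner b <= rho v * b v by rewrite mulrC ler_pdivrMr// mulrC.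
  set Y := N^-1 * _; set X1 := inner b; set X2 := inner b'; lra.
Qed.

Lemma dobrushin_iter b f n : (forall v, 0 <= b v) -> osc_le b f ->
  exists b' f', [/\ forall v, 0 <= b' v, osc_le b' f', same_means f' f,
    mass b' <= mass b &
    inner b' <= (1 - (2 * #|V|.+1%:R)^-1) ^+ n * inner b].
Proof.
move=> b0 bf; elim: n => [|n [b1 [f1 [b10 bf1 s1 m1 i1]]]].
  by exists b, f; split; rewrite // expr0 mul1r.
have [b2 [f2 [b20 bf2 s2 m2 i2]]] := dobrushin_step b10 bf1.
exists b2, f2; split => //.
- by move=> Q bQ; rewrite s2// s1.
- exact: le_trans m1.
- apply: (le_trans i2); rewrite exprS -mulrA ler_wpM2l// subr_ge0 invf_le1.
    by rewrite -natrM ler1n.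
  by rewrite mulr_gt0// ltr0n.
Qed.

(** After many updates the inner oscillation is negligible. The total mass has not grown and a
    boundary site has weight at least L, so the boundary oscillation is at most [mass b / L]. The
    updated function is then nearly constant, and its means on Q and Q' nearly agree. Multiplying by
    both normalising sums covers events without configurations as well. *)
Lemma dobrushin_decay (L : R) b f (Q Q' : pred cfg) : 0 < L ->
  (forall v, Bd v -> L <= rho v) ->
  (forall v, 0 <= b v) -> osc_le b f -> bd_event Q -> bd_event Q' ->
  `|(\sum_(x | Q x) W x * f x) * (\sum_(x | Q' x) W x) -
    (\sum_(x | Q x) W x) * (\sum_(x | Q' x) W x * f x)| <=
  mass b / L * ((\sum_(x | Q x) W x) * (\sum_(x | Q' x) W x)).
Proof.
move=> L0 rhoL b0 bf bQ bQ'.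
set Z := \sum_(x | Q x) W x; set Z' := \sum_(x | Q' x) W x.
have rho0 v : 0 <= rho v by rewrite (le_trans ler01).
have Z0 : 0 <= Z by apply: sumr_ge0 => x _; exact: ltW.
have Z'0 : 0 <= Z' by apply: sumr_ge0 => x _; exact: ltW.
set q : R := 1 - (2 * #|V|.+1%:R)^-1.
have q0 : 0 <= q.
  rewrite subr_ge0 invf_le1; first by rewrite -natrM ler1n.
  by rewrite mulr_gt0// ltr0n.
have q1 : q < 1 by rewrite ltrBlDr ltrDl invr_gt0 mulr_gt0// ltr0n.
apply/ler_addgt0Pr => e e0.
have [n qn] : exists n, q ^+ n * inner b * (Z * Z') <= e.
  have /cvgrPdist_le H : geometric (inner b * (Z * Z')) q @ \oo --> 0.
    by apply: cvg_geometric; rewrite ger0_norm.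
  have [n _ Hn] := H e e0.
  exists n; have := Hn n (leqnn n); rewrite sub0r normrN => Hn'.
  by rewrite -mulrA mulrC (le_trans (ler_norm _)).
have [b' [f' [b'0 bf' s' m' i']]] := dobrushin_iter n b0 bf.
rewrite -(s' _ bQ) -(s' _ bQ') /Z /Z'.
rewrite !big_distrlr/= -sumrB.
apply: (@le_trans _ _ (\sum_(x | Q x) \sum_(y | Q' y) (\sum_v b' v) * (W x * W y))).
  apply: (le_trans (ler_norm_sum _ _ _)); apply: ler_sum => x _.
  rewrite -sumrB; apply: (le_trans (ler_norm_sum _ _ _)); apply: ler_sum => y _.
  have -> : W x * f' x * W y - W x * (W y * f' y) = (f' x - f' y) * (W x * W y).
    by ring.
  rewrite normrM (gtr0_norm (mulr_gt0 (W_gt0 x) (W_gt0 y))).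
  by rewrite ler_wpM2r ?osc_total// ltW// mulr_gt0.
have -> : \sum_(x | Q x) \sum_(y | Q' y) (\sum_v b' v) * (W x * W y) =
    (\sum_v b' v) * (Z * Z').
  rewrite /Z /Z' big_distrlr/= mulr_sumr; apply: eq_bigr => x _.
  by rewrite mulr_sumr.
rewrite -!big_distrlr/= -/Z -/Z'.
have : \sum_v b' v <= q ^+ n * inner b + mass b / L.
  rewrite (bigID (fun v => ~~ Bd v))/=; apply: lerD.
    apply: le_trans i'; apply: ler_sum => v _.
    by rewrite ler_peMl.
  rewrite ler_pdivlMr//; apply: le_trans m'.
  rewrite [leRHS](bigID (fun v => ~~ Bd v))/=.
  rewrite mulr_suml; apply: (@le_trans _ _ (\sum_(v | ~~ ~~ Bd v) rho v * b' v)).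
    apply: ler_sum => v; rewrite negbK => vB.
    by rewrite mulrC ler_wpM2r// rhoL.
  by rewrite lerDr; apply: sumr_ge0 => v _; exact: mulr_ge0.
move=> /(ler_wpM2r (mulr_ge0 Z0 Z'0)) H; apply: (le_trans H).
by rewrite mulrDl addrC lerD2l.
Qed.

End Dobrushin.

(** * Trails in the dual lattice *)

Section Trails.
Local Open Scope nat_scope.

(** [inl (j, c)] joins (j, c) to (j+1, c), and [inr (j, c)] joins (j+1, c) to (j+1, c+1): j is the
    time of the observation minus one. Row 0 thus has no edges of its own, the observations starting
    at time 1. *)
Definition edge := ((nat * nat) + (nat * nat))%type.

Definition cobd (x : nat -> nat -> bool) (e : edge) : bool :=
  match e with
  | inl (j, c) => x j c (+) x j.+1 c
  | inr (j, c) => x j.+1 c (+) x j.+1 c.+1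
  end.

Definition in_box k m (e : edge) : bool :=
  match e with
  | inl (j, c) => (j < k) && (c <= m)
  | inr (j, c) => (j < k) && (c < m)
  end.

Definition box_edges k m : seq edge :=
  [seq inl (j, c) | j <- iota 0 k, c <- iota 0 m.+1] ++
  [seq inr (j, c) | j <- iota 0 k, c <- iota 0 m].

Lemma mem_box_edges k m e : (e \in box_edges k m) = in_box k m e.
Proof.
rewrite mem_cat; case: e => [[j c]|[j c]]; rewrite /in_box; apply/orP/idP.
- case=> /allpairsPdep[j' [c' [+ +]]] => // + + [-> ->].
  by rewrite !mem_iota !add0n ltnS => /andP[_ ->] /andP[_ ->].
- move=> /andP[jk cm]; left; apply/allpairsPdep; exists j, c.
  by rewrite !mem_iota !add0n ltnS.
- case=> /allpairsPdep[j' [c' [+ +]]] => // + + [-> ->].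
  by rewrite !mem_iota !add0n => /andP[_ ->] /andP[_ ->].
- move=> /andP[jk cm]; right; apply/allpairsPdep; exists j, c.
  by rewrite !mem_iota !add0n.
Qed.

Lemma uniq_box_edges k m : uniq (box_edges k m).
Proof.
rewrite cat_uniq; apply/and3P; split.
- by rewrite allpairs_uniq ?iota_uniq// => -[a b] [a' b'] _ _ [-> ->].
- apply/hasPn => e /allpairsPdep[j [c [_ _ ->]]]; apply/negP.
  by move=> /allpairsPdep[j' [c' []]].
- by rewrite allpairs_uniq ?iota_uniq// => -[a b] [a' b'] _ _ [-> ->].
Qed.

(* The plaquette (j, c) has corners (j, c), (j, c+1), (j+1, c), (j+1, c+1).
   Each side comes with the plaquette on its other side; this is a junk value
   when the side lies on the boundary of the box.  There is no side inr
   between the sites of row 0, whose values are known. *)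
Definition sides (q : nat * nat) : seq (edge * (nat * nat)) :=
  [:: (inl q, (q.1, q.2.-1)); (inl (q.1, q.2.+1), (q.1, q.2.+1));
      (inr q, (q.1.+1, q.2))] ++
  (if q.1 is j.+1 then [:: (inr (j, q.2), (j, q.2))] else [::]).

(** The lists of edges crossed by n-step walks in the dual lattice from q. Walks through junk
    plaquettes are included, which is harmless for an upper bound on their number. *)
Fixpoint walks n (q : nat * nat) : seq (seq edge) :=
  if n is n'.+1 then
    flatten [seq [seq s.1 :: w | w <- walks n' s.2] | s <- sides q]
  else [:: [::]].

Lemma walks_cons n q s w : s \in sides q -> w \in walks n s.2 ->
  s.1 :: w \in walks n.+1 q.
Proof.
by move=> sq ws; apply/flatten_mapP; exists s => //; exact: map_f.
Qed.

Lemma size_walks n q : size (walks n q) <= 4 ^ n.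
Proof.
elim: n q => //= n IH [j c].
case: j => [|j] /=; rewrite !size_cat !size_map expnS.
- by have := IH (0, c.-1); have := IH (0, c.+1); have := IH (1, c) => /=; lia.
- by have := IH (j.+1, c.-1); have := IH (j.+1, c.+1); have := IH (j.+2, c);
    have := IH (j, c) => /=; lia.
Qed.

Lemma size_in_walks n q w : w \in walks n q -> size w = n.
Proof.
elim: n q w => [|n IH] q w; first by rewrite inE => /eqP ->.
by case/flatten_mapP => s _ /mapP[w' /IH <- ->].
Qed.

(** The boundary modulo 2 of K as a chain of dual edges. In the lowest row of plaquettes the missing
    lower side contributes nothing. *)
Definition par (K : edge -> bool) (q : nat * nat) : bool :=
  K (inl q) (+) K (inl (q.1, q.2.+1)) (+) K (inr q) (+)
  (if q.1 is j.+1 then K (inr (j, q.2)) else false).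

(** The integral of K modulo 2 along column c from time 0: the only candidate for a configuration
    with coboundary K that vanishes at time 0. *)
Fixpoint col (K : edge -> bool) j c : bool :=
  if j is j'.+1 then col K j' c (+) K (inl (j', c)) else false.

Lemma parD K L q : par (fun e => K e (+) L e) q = par K q (+) par L q.
Proof.
rewrite /par; case: q.1 => [|j];
  repeat (match goal with |- context [K ?e] => case: (K e) end);
  repeat (match goal with |- context [L ?e] => case: (L e) end); by [].
Qed.

Lemma colD K L j c : col (fun e => K e (+) L e) j c = col K j c (+) col L j c.
Proof.
elim: j => //= j ->.
by case: (col K j c); case: (col L j c); case: (K _); case: (L _).
Qed.

Lemma eq_par K L : K =1 L -> par K =1 par L.
Proof. by move=> KL q; rewrite /par !KL; case: q.1 => // j; rewrite KL. Qed.

Lemma eq_col K L : K =1 L -> col K =2 col L.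
Proof. by move=> KL j c; elim: j => //= j ->; rewrite KL. Qed.

Lemma par_inl j c j' c' : par (pred1 (inl (j, c))) (j', c') =
  ((j', c') == (j, c)) (+) ((j', c'.+1) == (j, c)).
Proof.
rewrite /par /= -[inl (j', c') == _]/((j', c') == (j, c)).
rewrite -[inl (j', c'.+1) == _]/((j', c'.+1) == (j, c)) !addbF.
by case: j' => [|j']; rewrite addbF.
Qed.

Lemma par_inr j c j' c' : par (pred1 (inr (j, c))) (j', c') =
  ((j', c') == (j, c)) (+) ((j', c') == (j.+1, c)).
Proof.
rewrite /par /=.
rewrite -[inr (j', c') == _]/((j', c') == (j, c)).
by case: j' => [|j'].
Qed.

Lemma col_inl j c k c' : col (pred1 (inl (j, c))) k c' = (j < k) && (c' == c).
Proof.
elim: k => //= k ->.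
rewrite -[inl (k, c') == _]/((k, c') == (j, c)) xpair_eqE ltnS.
by case: (c' == c); rewrite ?andbF// ?andbT; case: ltngtP.
Qed.

Lemma col_inr j c k c' : col (pred1 (inr (j, c))) k c' = false.
Proof. by elim: k => //= k ->. Qed.

Lemma mem_rem_xor (K : seq edge) e : uniq K -> e \in K ->
  forall e', (e' \in rem e K) = (e' \in K) (+) (e' == e).
Proof.
move=> uK eK e'; rewrite mem_rem_uniq// inE /=.
by have [->|] := eqVneq e' e; rewrite ?eK// addbF.
Qed.

Lemma mem_cons_xor (W : seq edge) e : e \notin W ->
  forall e', (e' \in e :: W) = (e' == e) (+) (e' \in W).
Proof.
by move=> eW e'; rewrite inE; have [->|//] := eqVneq e' e; rewrite (negbTE eW).
Qed.

Variables k m : nat.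

Definition plaquette (q : nat * nat) := (q.1 < k) && (q.2 < m).

(** A side leads to a neighbouring plaquette, which is at most one step closer to the top and right
    sides of the box, or leaves the box. The bottom offers no exit. The exit on the left is the one
    that [col _ k 0] detects, so any other exit means that the top or the right side is adjacent. *)
Lemma plaquette_exit q s : plaquette q -> s \in sides q -> in_box k m s.1 ->
  (forall q', plaquette q' -> par (pred1 s.1) q' = (q' == q)) /\
    (col (pred1 s.1) k 0 = false -> minn (k - q.1) (m - q.2) <= 1) \/
  [/\ plaquette s.2,
    forall q', plaquette q' -> par (pred1 s.1) q' = (q' == q) (+) (q' == s.2),
    col (pred1 s.1) k 0 = false &
    minn (k - q.1) (m - q.2) <= (minn (k - s.2.1) (m - s.2.2)).+1].
Proof.
case: q => j c; rewrite /plaquette /= => /andP[jk cm].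
rewrite mem_cat !inE => /orP[/or3P[/eqP->|/eqP->|/eqP->]|] /=.
- move=> _; case: c cm => [|c] cm /=; [left|right].
    split => [[j' c'] _|].
      by rewrite par_inl !xpair_eqE andbF addbF.
    by rewrite col_inl jk.
  split; first by rewrite jk ltnW.
  + by move=> [j' c'] _; rewrite par_inl !xpair_eqE eqSS.
  + by rewrite col_inl andbF.
  + by lia.
- move=> _; have [cm'|cm'] := ltnP c.+1 m; [right|left].
    split; rewrite ?jk//; last by lia.
    + by move=> [j' c'] _; rewrite par_inl !xpair_eqE eqSS addbC.
    + by rewrite col_inl andbF.
  split => [[j' c'] /andP[_ /= c'm]|_]; last by lia.
  rewrite par_inl !xpair_eqE eqSS; have -> : (c' == c.+1) = false by lia.
  by rewrite andbF.
- move=> _; have [jk'|jk'] := ltnP j.+1 k; [right|left].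
    split; rewrite ?cm//; last by lia.
    + by move=> [j' c'] _; rewrite par_inr !xpair_eqE.
    + by rewrite col_inr.
  split => [[j' c'] /andP[/= j'k _]|_]; last by lia.
  rewrite par_inr !xpair_eqE; have -> : (j' == j.+1) = false by lia.
  by rewrite addbF.
- case: j jk => // j jk; rewrite inE => /eqP -> /= _; right.
  split; rewrite ?cm ?(ltnW jk)//; last by lia.
  + by move=> [j' c'] _; rewrite par_inr addbC.
  + by rewrite col_inr.
Qed.

Lemma par_side (K : seq edge) q : par (mem K) q ->
  exists2 s, s \in sides q & s.1 \in K.
Proof.
case: q => j c; rewrite /par /=.
have [? _|_] := boolP (inl (j, c) \in K).
  by exists (inl (j, c), (j, c.-1)); rewrite ?inE ?eqxx.
have [? _|_] := boolP (inl (j, c.+1) \in K).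
  by exists (inl (j, c.+1), (j, c.+1)); rewrite ?inE ?eqxx ?orbT.
have [? _|_] := boolP (inr (j, c) \in K).
  by exists (inr (j, c), (j.+1, c)); rewrite ?inE ?eqxx ?orbT.
case: j => // j /= H.
by exists (inr (j, c), (j, c)); rewrite ?inE ?eqxx ?orbT.
Qed.

(** Since q is the only odd plaquette, some side of q is in K. Deleting that side moves the defect
    to the plaquette beyond it, until the trail leaves the box. Each step lowers the distance to the
    top and right sides by at most one, which gives the size bound unless the exit is through column
    0. *)
Lemma exists_trail n (K : seq edge) q : size K <= n -> uniq K ->
  all (in_box k m) K -> plaquette q ->
  (forall q', plaquette q' -> par (mem K) q' = (q' == q)) ->
  exists W, [/\ uniq W, {subset W <= K}, W \in walks (size W) q,
    forall q', plaquette q' -> par (mem W) q' = (q' == q) &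
    col (mem W) k 0 = false -> minn (k - q.1) (m - q.2) <= size W].
Proof.
elim: n K q => [|n IH] K q.
  rewrite leqn0 size_eq0 => /eqP -> _ _ plq /(_ q plq).
  by rewrite eqxx /par /=; case: q.1.
move=> Kn uK Kbox plq Kq.
have [s sq sK] : exists2 s, s \in sides q & s.1 \in K.
  by apply: par_side; rewrite Kq// eqxx.
have [[sex smin]|[pl2 spar scol smin]] :=
    plaquette_exit plq sq (allP Kbox _ sK).
  have e1 : mem [:: s.1] =1 pred1 s.1 by move=> e /=; rewrite inE.
  exists [:: s.1]; split => //.
  - by move=> e; rewrite inE => /eqP ->.
  - exact: (@walks_cons 0).
  - by move=> q' plq'; rewrite (eq_par e1) sex.
  - by rewrite (eq_col e1) => /smin.
have [] := IH (rem s.1 K) s.2 _ _ _ pl2.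
- by rewrite size_rem// -ltnS (leq_trans _ Kn)// ltn_predL; case: (K) sK.
- exact: rem_uniq.
- by apply/allP => e /mem_rem; exact: (allP Kbox).
- move=> q' plq'; rewrite (eq_par (mem_rem_xor uK sK)) parD spar// Kq//.
  by rewrite addbA addbb.
move=> W [uW WK Ww Wpar Wmin].
have sW : s.1 \notin W.
  by apply/negP => /WK; rewrite mem_rem_uniq// inE eqxx.
exists (s.1 :: W); split.
- by rewrite /= sW.
- by move=> e; rewrite inE => /predU1P[->//|/WK /mem_rem].
- exact: walks_cons.
- move=> q' plq'; rewrite (eq_par (mem_cons_xor sW)) parD spar// Wpar//.
  by rewrite -addbA addbb addbF.
- rewrite (eq_col (mem_cons_xor sW)) colD scol addFb => /Wmin Wm.
  exact: leq_trans smin _.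
Qed.

(** K crosses column 0 an odd number of times. A trail started at one crossing either ends at the
    top or right side, as wanted, or comes back to column 0. In the second case it contains an even
    number of crossings and can be removed from K without changing any parity; the induction
    continues on the smaller set. *)
Lemma exists_crossing n (K : seq edge) : size K <= n -> uniq K ->
  all (in_box k m) K -> 0 < m ->
  (forall q, plaquette q -> par (mem K) q = false) -> col (mem K) k 0 ->
  exists j W, [/\ j < k, uniq (inl (j, 0) :: W) & {subset inl (j, 0) :: W <= K}] /\
    [/\ W \in walks (size W) (j, 0), minn (k - j) m <= size W &
    forall q, plaquette q -> par (mem (inl (j, 0) :: W)) q = false].
Proof.
move=> + + + m0; elim: n K => [|n IH] K.
  rewrite leqn0 size_eq0 => /eqP -> _ _ _.
  suff -> : col (mem [::]) k 0 = false by [].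
  by elim: (k) => //= i ->.
move=> Kn uK Kbox Keven Kcol.
have [j jk jK] : exists2 j, j < k & inl (j, 0) \in K.
  elim: (k) Kcol => //= i IHi; have [iK _|_] := boolP (inl (i, 0) \in K).
    by exists i.
  by rewrite addbF => /IHi[j ji jK]; exists j => //; exact: ltnW.
set e : edge := inl (j, 0).
have plj : plaquette (j, 0) by rewrite /plaquette jk.
have epar q : plaquette q -> par (pred1 e) q = (q == (j, 0)).
  by case: q => j' c' _; rewrite par_inl !xpair_eqE andbF addbF.
have [] := @exists_trail n (rem e K) (j, 0).
- by rewrite size_rem// -ltnS (leq_trans _ Kn)// ltn_predL; case: (K) jK.
- exact: rem_uniq.
- by apply/allP => e' /mem_rem; exact: (allP Kbox).
- exact: plj.
- by move=> q plq; rewrite (eq_par (mem_rem_xor uK jK)) parD epar// Keven.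
move=> W [uW WK Ww Wpar Wmin].
have eW : e \notin W by apply/negP => /WK; rewrite mem_rem_uniq// inE eqxx.
have WK' : {subset e :: W <= K}.
  by move=> e'; rewrite inE => /predU1P[->//|/WK /mem_rem].
have Weven q : plaquette q -> par (mem (e :: W)) q = false.
  by move=> plq; rewrite (eq_par (mem_cons_xor eW)) parD epar// Wpar// addbb.
have [Wcol|Wcol] := boolP (col (mem W) k 0); last first.
  exists j, W; split; split => //; first by rewrite /= eW.
  by have := Wmin (negbTE Wcol); rewrite subn0.
pose K' := [seq e' <- K | e' \notin e :: W].
have K'E : mem K' =1 (fun e' => (e' \in K) (+) (e' \in e :: W)).
  move=> e' /=; rewrite mem_filter; have [/WK' ->//|] := boolP (e' \in e :: W).
  by rewrite addbF.
have [] := IH K'.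
- rewrite -ltnS (leq_trans _ Kn)// size_filter -(count_predC (mem (e :: W)) K).
  rewrite -[X in X < _]add0n ltn_add2r -has_count; apply/hasP; exists e => //.
  by rewrite /= mem_head.
- exact: filter_uniq.
- by apply/allP => e'; rewrite mem_filter => /andP[_]; exact: (allP Kbox).
- by move=> q plq; rewrite (eq_par K'E) parD Keven// Weven.
- rewrite (eq_col K'E) colD Kcol (eq_col (mem_cons_xor eW)) colD Wcol.
  by rewrite col_inl jk.
move=> i [W' [[ik uW' W'K] H]]; exists i, W'; split => //; split => //.
by move=> e' /W'K; rewrite mem_filter => /andP[].
Qed.

(** A discrete Poincaré lemma: a set of edges with even plaquettes is closed, and integration along
    the columns gives a primitive. Time edges are immediate; for space edges the plaquette parities
    are added up from the bottom row. *)
Lemma cobd_col (W : edge -> bool) e :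
  (forall q, plaquette q -> par W q = false) -> in_box k m e ->
  cobd (col W) e = W e.
Proof.
move=> Weven; case: e => [[j c] _|[j c] /= /andP[jk cm]].
  by rewrite /= addbA addbb.
elim: j jk => [|j IH] jk.
  have := Weven (0, c); rewrite /plaquette /= jk cm => /(_ isT).
  by rewrite /par /= addbF; do 3! case: (W _).
have := Weven (j.+1, c); rewrite /plaquette /= jk cm => /(_ isT).
have := IH (ltnW jk); rewrite /par /=.
case: (col W j c); case: (col W j c.+1); by do 6! case: (W _).
Qed.

Definition cost (Y : edge -> bool) x :=
  count (fun e => Y e (+) cobd x e) (box_edges k m).

(* Peierls' argument: flipping the estimate on one side of the trail does not
   decrease the cost, so at least half of the edges of the trail are noisy. *)
Lemma noisy_crossing (Y : edge -> bool) (x z : nat -> nat -> bool) : 0 < m ->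
  (forall c, c <= m -> z 0 c = x 0 c) -> z k 0 != x k 0 ->
  (forall t : nat -> nat -> bool, (forall c, c <= m -> t 0 c = x 0 c) ->
    cost Y z <= cost Y t) ->
  exists j W, [/\ j < k, uniq (inl (j, 0) :: W) &
    all (in_box k m) (inl (j, 0) :: W)] /\
    [/\ W \in walks (size W) (j, 0), minn (k - j) m <= size W &
      size W < (count (fun e => Y e (+) cobd x e) (inl (j, 0) :: W)).*2].
Proof.
move=> m0 zx0 zxk zmin.
pose D j c := z j c (+) x j c.
have cobdD e : cobd D e = cobd z e (+) cobd x e.
  by case: e => [[j c]|[j c]] /=; rewrite /D addbACA.
pose K := [seq e <- box_edges k m | cobd D e].
have KE e : in_box k m e -> (e \in K) = cobd D e.
  by move=> eb; rewrite mem_filter mem_box_edges eb andbT.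
have [] := @exists_crossing (size K) K (leqnn _).
- exact/filter_uniq/uniq_box_edges.
- by apply/allP => e; rewrite mem_filter mem_box_edges => /andP[].
- exact: m0.
- move=> [j c] /andP[/= jk cm].
  have cm' : c <= m by exact: ltnW.
  rewrite /par /= !KE /= ?jk ?cm ?cm'//.
  case: j jk => [|j] jk; last first.
    rewrite KE /= ?cm ?(ltnW jk)//.
    by case: (D j.+1 c); case: (D j.+1 c.+1); case: (D j.+2 c); case: (D j.+2 c.+1).
  have D0 c0 : c0 <= m -> D 0 c0 = false by move=> ?; rewrite /D zx0// addbb.
  by rewrite !D0//; case: (D _ c); case: (D _ c.+1).
- suff H j : j <= k -> col (mem K) j 0 = D j 0.
    by rewrite H// /D; move: zxk; case: (z k 0); case: (x k 0).
  elim: j => [_|j IH jk] /=; first by rewrite /D zx0// addbb.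
  by rewrite IH ?(ltnW jk)// KE/= ?jk// addbA addbb.
move=> j [W [[jk uW WK] [Ww Wmin Weven]]].
set W1 := _ :: W in uW WK Weven.
have Wbox : all (in_box k m) W1.
  by apply/allP => e /WK; rewrite mem_filter mem_box_edges => /andP[].
exists j, W; split; split => //; rewrite -/W1.
(* The competitor: within the box its coboundary differs from that of z exactly on [W1], and it
   still agrees with x at time 0. *)
pose t j c := z j c (+) col (mem W1) j c.
pose p e := Y e (+) cobd z e.
have cobdt e : in_box k m e -> Y e (+) cobd t e = p e (+) (e \in W1).
  move=> eb; rewrite /p -addbA -[e \in W1](cobd_col Weven eb); congr (_ (+) _).
  case: e eb => [[i c]|[i c]] _; rewrite /t /cobd.
    by case: (z i c); case: (z i.+1 c); case: (col _ i c); case: (col _ i.+1 c).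
  by case: (z _ c); case: (z _ c.+1); case: (col _ _ c); case: (col _ _ c.+1).
have perm : perm_eq (box_edges k m)
    (W1 ++ [seq e <- box_edges k m | e \notin W1]).
  apply: uniq_perm; first exact: uniq_box_edges.
    rewrite cat_uniq uW andTb filter_uniq ?uniq_box_edges// andbT.
    by apply/hasPn => e; rewrite mem_filter => /andP[].
  move=> e; rewrite mem_box_edges mem_cat mem_filter mem_box_edges.
  have [/(allP Wbox) ->//|//] := boolP (e \in W1).
have : cost Y z <= cost Y t.
  by apply: zmin => c cm; rewrite /t /= addbF zx0.
rewrite /cost !(permP perm) !count_cat.
have -> : count (fun e => Y e (+) cobd t e) [seq e <- box_edges k m | e \notin W1]
    = count p [seq e <- box_edges k m | e \notin W1].
  apply: eq_in_count => e; rewrite mem_filter mem_box_edges => /andP[eW eb].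
  by rewrite cobdt// (negbTE eW) addbF.
rewrite leq_add2r.
have Wp e : e \in W1 -> Y e (+) cobd t e = ~~ p e.
  by move=> eW; rewrite cobdt ?eW ?addbT// (allP Wbox).
(* On [W1], a part of [K], the coboundaries of z and x differ, so an edge is noisy exactly when z
   does not violate it. The minimality of z then says that at most half of these edges are not
   noisy. *)
have Wp' e : e \in W1 -> Y e (+) cobd x e = ~~ p e.
  move=> eW; rewrite /p; have := WK _ eW; rewrite mem_filter cobdD => /andP[+ _].
  by case: (Y e); case: (cobd z e); case: (cobd x e).
rewrite (eq_in_count Wp) (eq_in_count Wp').
have : count p W1 + count (fun e => ~~ p e) W1 = (size W).+1.
  exact: count_predC.
by set a := count p W1; set b := count _ W1; lia.
Qed.

End Trails.

(** * Approximation of events *)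

Definition pr d (T : measurableType d) (R : realType) (P : probability T R)
  (A : set T) : R := fine (P A).

Section RealProbability.
Context d (T : measurableType d) (R : realType) (P : probability T R).

Lemma prE (A : set T) : measurable A -> P A = (pr P A)%:E.
Proof. by move=> mA; rewrite fineK// fin_num_measure. Qed.

Lemma pr_ge0 (A : set T) : 0 <= pr P A.
Proof. exact: fine_ge0. Qed.

Lemma pr_le1 (A : set T) : measurable A -> pr P A <= 1.
Proof. by move=> mA; rewrite -lee_fin -prE// probability_le1. Qed.

Lemma pr0 : pr P set0 = 0.
Proof. by rewrite /pr measure0. Qed.

Lemma le_pr (A B : set T) : measurable A -> measurable B -> A `<=` B ->
  pr P A <= pr P B.
Proof.
by move=> mA mB AB; rewrite -lee_fin -!prE//; apply: le_measure => //; rewrite inE.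
Qed.

Lemma pr_setDI (A B : set T) : measurable A -> measurable B ->
  pr P A = pr P (A `&` B) + pr P (A `\` B).
Proof.
move=> mA mB; apply: EFin_inj; rewrite EFinD -!prE//.
- by rewrite addeC; exact: measureDI.
- exact: measurableD.
- exact: measurableI.
Qed.

Lemma pr_setU_le (A B : set T) : measurable A -> measurable B ->
  pr P (A `|` B) <= pr P A + pr P B.
Proof.
move=> mA mB; rewrite -lee_fin EFinD -!prE//; first exact: measureU2.
exact: measurableU.
Qed.

Lemma measurable_setY (A B : set T) : measurable A -> measurable B ->
  measurable (A `+` B).
Proof. by move=> mA mB; apply: measurableU; exact: measurableD. Qed.

Lemma pr_setY_ge (A B : set T) : measurable A -> measurable B ->
  `|pr P A - pr P B| <= pr P (A `+` B).
Proof.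
move=> mA mB; rewrite (pr_setDI mA mB) (pr_setDI mB mA) setIC.
have mAB := measurable_setY mA mB.
have H1 : pr P (A `\` B) <= pr P (A `+` B).
  by apply: le_pr => //; [exact: measurableD|exact: subsetUl].
have H2 : pr P (B `\` A) <= pr P (A `+` B).
  by apply: le_pr => //; [exact: measurableD|exact: subsetUr].
have := pr_ge0 (A `\` B); have := pr_ge0 (B `\` A).
by rewrite ler_norml => ? ?; apply/andP; split; lra.
Qed.

Lemma pr_bigsetU_le (I : Type) (s : seq I) (F : I -> set T) :
  (forall i, measurable (F i)) ->
  pr P (\big[setU/set0]_(i <- s) F i) <= \sum_(i <- s) pr P (F i).
Proof.
move=> mF; elim: s => [|i s IH]; first by rewrite !big_nil pr0.
rewrite !big_cons; apply: le_trans (lerD (lexx _) IH).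
by apply: pr_setU_le => //; apply: bigsetU_measurable.
Qed.

(* The uniformity in i makes the lemma apply at once to all the (identically
   distributed) configurations at times 0, 1, 2, ... *)
Lemma approx_g_sigma_algebra (U I : Type) (i0 : I) (phi : I -> T -> U)
    (D : set U) (G : set (set U)) :
  (forall i w, D (phi i w)) ->
  (forall C, G C -> forall i, measurable (phi i @^-1` C)) ->
  (forall C, G C -> forall i j, pr P (phi i @^-1` C) = pr P (phi j @^-1` C)) ->
  G set0 -> (forall C, G C -> G (~` C)) ->
  (forall C C', G C -> G C' -> G (C `|` C')) ->
  forall B, <<s D, G >> B -> (forall i, measurable (phi i @^-1` B)) /\
    forall e, 0 < e -> exists2 C, G C &
      forall i, pr P (phi i @^-1` (B `+` C)) <= e.
Proof.
move=> phiD mG Geq G0 GC GU.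
pose good := [set B : set U | (forall i, measurable (phi i @^-1` B)) /\
  forall e, 0 < e -> exists2 C, G C &
      forall i, pr P (phi i @^-1` (B `+` C)) <= e].
have mY B C i : good B -> G C -> measurable (phi i @^-1` (B `+` C)).
  by move=> [mB _] GC'; exact: (measurable_setY (mB i) (mG _ GC' i)).
have goodG C : G C -> good C.
  move=> GC'; split; first exact: mG.
  move=> e e0; exists C => // i.
  by rewrite /setY setDv setU0 preimage_set0 pr0 ltW.
have good_eq B : good B -> forall i j, pr P (phi i @^-1` B) = pr P (phi j @^-1` B).
  move=> gB i j; have [mB aB] := gB; apply/eqP; rewrite -subr_eq0 -normr_le0.
  apply/ler_addgt0Pr => e e0; rewrite add0r.
  have [C GC' HC] := aB (e / 2) (divr_gt0 e0 (ltr0Sn _ 1)).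
  have Hi := le_trans (pr_setY_ge (mB i) (mG _ GC' i)) (HC i).
  have Hj := le_trans (pr_setY_ge (mB j) (mG _ GC' j)) (HC j).
  rewrite (Geq _ GC' i j) in Hi.
  move: Hi Hj; rewrite !ler_norml => /andP[? ?] /andP[? ?].
  by apply/andP; split; lra.
have goodU A B : good A -> good B -> good (A `|` B).
  move=> gA gB; have [mA aA] := gA; have [mB aB] := gB.
  split; first by move=> i; rewrite preimage_setU; exact: measurableU.
  move=> e e0; have e20 : 0 < e / 2 by rewrite divr_gt0.
  have [C GC' HC] := aA _ e20; have [C' GC'' HC'] := aB _ e20.
  exists (C `|` C'); first exact: GU.
  move=> i; apply: (@le_trans _ _ (pr P (phi i @^-1` (A `+` C) `|`
      phi i @^-1` (B `+` C')))).
    apply: le_pr.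
    - apply: (measurable_setY (measurableU _ _ (mA i) (mB i))).
      exact: (measurableU _ _ (mG _ GC' i) (mG _ GC'' i)).
    - by apply: measurableU; exact: mY.
    - move=> w /=; set a := A _; set b := B _; set c := C _; set c' := C' _.
      by move=> [[[] ? /not_orP[? ?]]|[[] ? /not_orP[? ?]]]; tauto.
  apply: (le_trans (pr_setU_le _ _)); [exact: mY|exact: mY|].
  by have := HC i; have := HC' i; lra.
have goodD : sigma_algebra D good.
  split; first exact: goodG.
    move=> B gB; have [mB aB] := gB.
    have phiE i : phi i @^-1` (D `\` B) = ~` (phi i @^-1` B).
      by apply/seteqP; split => w /=; [case|move=> ?; split => //; exact: phiD].
    split; first by move=> i; rewrite phiE; exact: measurableC.
    move=> e e0; have [C GC' HC] := aB e e0; exists (~` C); first exact: GC.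
    move=> i; apply: le_trans (HC i); apply: le_pr.
    - have mDB : measurable (phi i @^-1` (D `\` B)).
        by rewrite phiE; exact: measurableC.
      exact: (measurable_setY mDB (mG _ (GC _ GC') i)).
    - exact: mY.
    - move=> w /=; have := phiD i w; set a := B _; set c := C _; set dd := D _.
      by have [] := pselect a; have [] := pselect c; tauto.
  move=> F gF; pose S N := \big[setU/set0]_(n < N.+1) F n.
  have gS N : good (S N).
    rewrite /S; elim: N => [|N IH]; first by rewrite big_ord1.
    by rewrite big_ord_recr; exact: goodU.
  have SF : \bigcup_N S N = \bigcup_n F n by exact: bigcup_bigsetU_bigcup.
  have mF i : measurable (phi i @^-1` \bigcup_n F n).
    by rewrite preimage_bigcup; apply: bigcup_measurable => n _; case: (gF n).
  have cF i : (fun N => P (phi i @^-1` S N)) @ \oo -->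
      P (phi i @^-1` \bigcup_n F n).
    rewrite -SF preimage_bigcup.
    apply: (@nondecreasing_cvg_mu _ _ _ P (fun N => phi i @^-1` S N)).
    - by move=> N; case: (gS N).
    - by rewrite -preimage_bigcup SF.
    - move=> m n mn; apply/subsetPset => w.
      by apply: (@subset_bigsetU _ F m.+1 n.+1); rewrite ltnS.
  (* The limit is the same for every i, so an N chosen at [i0] serves all i at once. *)
  have eqF i : pr P (phi i @^-1` \bigcup_n F n) =
      pr P (phi i0 @^-1` \bigcup_n F n).
    congr fine; apply: (cvg_unique _ (cF i)) => //.
    apply: cvg_trans (cF i0); apply: near_eq_cvg; near=> N.
    have [mSN _] := gS N.
    by rewrite !prE// (good_eq _ (gS N) i0 i).
  split=> // e e0; have e20 : 0 < e / 2 by rewrite divr_gt0.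
  have [N HN] : exists N, pr P (phi i0 @^-1` \bigcup_n F n) -
      pr P (phi i0 @^-1` S N) <= e / 2.
    have := cF i0; rewrite (prE (mF i0)) => /fine_cvgP[_ /cvgrPdist_le].
    move=> /(_ _ e20)[N _ HN]; exists N; have := HN N (leqnn N).
    by rewrite ler_norml => /andP[].
  have [C GC' HC] := (gS N).2 _ e20.
  exists C => // i; have mS := (gS N).1 i.
  apply: (@le_trans _ _ (pr P ((phi i @^-1` \bigcup_n F n) `\` (phi i @^-1` S N)) +
      pr P (phi i @^-1` (S N `+` C)))).
    apply: le_trans (pr_setU_le _ _).
    - apply: le_pr.
      + exact: (measurable_setY (mF i) (mG _ GC' i)).
      + by apply: measurableU; [exact: measurableD|exact: mY].
      + move=> w /=; have := @bigsetU_bigcup _ F N.+1 (phi i w).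
        rewrite -/(S N); set a := (\bigcup_n F n) _; set b := S N _; set c := C _.
        by have [] := pselect b; tauto.
    - exact: measurableD.
    - exact: mY.
  have := pr_setDI (mF i) mS; rewrite setIidr; last first.
    by apply: preimage_subset; exact: bigsetU_bigcup.
  by rewrite eqF (good_eq _ (gS N) i i0) => ?; have := HC i; lra.
have sub : <<s D, G >> `<=` good by apply: smallest_sub.
by move=> B /sub.
Unshelve. all: by end_near.
Qed.

End RealProbability.

(** * Events determined by finitely many bits *)

Section FiniteInformation.
Context d (T : measurableType d).

Lemma measurable_fintype_fiber (I : finType) (z : I -> T -> bool) x :
  (forall i, measurable [set w | z i w]) ->
  measurable [set w | forall i, z i w = x i].
Proof.
move=> mz; have -> : [set w | forall i, z i w = x i] =
    \bigcap_(i in [set: I]) [set w | z i w = x i].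
  by apply/seteqP; split => w /= H; [move=> i _; exact: H|move=> i; exact: H].
apply: fin_bigcap_measurable => [|i _]; first exact: finite_finset.
case: (x i); first exact: mz.
have -> : [set w | z i w = false] = ~` [set w | z i w].
  by apply/seteqP; split => w /=; case: (z i w).
exact/measurableC/mz.
Qed.

(** The event is a finite union of fibres of the bits. Applied to T equipped with a generated
    sigma-algebra, it places local events in that sigma-algebra. *)
Lemma measurable_determined (I : finType) (z : I -> T -> bool) (C : set T) :
  (forall i, measurable [set w | z i w]) ->
  (forall w w', (forall i, z i w = z i w') -> C w -> C w') ->
  measurable C.
Proof.
move=> mz zC.
have -> : C = \bigcup_(x in [set x : {ffun I -> bool} |
    exists2 w, C w & forall i, z i w = x i]) [set w | forall i, z i w = x i].
  apply/seteqP; split => w /=.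
    move=> Cw; exists [ffun i => z i w]; last by move=> i /=; rewrite ffunE.
    by exists w => // i; rewrite ffunE.
  by move=> [x /= [w' Cw' zw'] zw]; apply: zC Cw' => i; rewrite zw'.
apply: fin_bigcup_measurable => [|x _]; first exact: finite_finset.
exact: measurable_fintype_fiber.
Qed.

Lemma pr_sum_fibers (R : realType) (P : probability T R) (I : finType)
    (Z : T -> I) (C : pred I) : (forall z, measurable [set w | Z w = z]) ->
  pr P [set w | C (Z w)] = \sum_(z | C z) pr P [set w | Z w = z].
Proof.
move=> mZ; have CE : [set w | C (Z w)] =
    \bigcup_(z in [set` enum C]) [set w | Z w = z].
  apply/seteqP; split => w /=.
    by move=> Cw; exists (Z w) => //=; rewrite mem_enum.
  by move=> [z /= zC zw]; move: zC; rewrite mem_enum -zw.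
rewrite /pr CE measure_fin_bigcup//.
- rewrite -fsbig_seq ?enum_uniq//= -sum_fine => [|z _]; last first.
    by rewrite fin_num_measure.
  by rewrite big_enum.
- by move=> z z' _ _ [w [h1 h2]]; rewrite -[z]h1 -[z']h2.
Qed.

Lemma pr_split_fibers (R : realType) (P : probability T R) (I : finType)
    (Z : T -> I) (F : set T) : (forall z, measurable [set w | Z w = z]) ->
  measurable F -> pr P F = \sum_z pr P ([set w | Z w = z] `&` F).
Proof.
move=> mZ mF; pose ZF w := (Z w, `[< F w >]).
have mZF z : measurable [set w | ZF w = z].
  case: z => z b; have -> : [set w | ZF w = (z, b)] =
      [set w | Z w = z] `&` (if b then F else ~` F).
    apply/seteqP; rewrite /ZF; split => w /= -[->].
      by case: b => [/asboolP|/asboolPn].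
    by case: b => [/asboolT ->|/asboolF ->].
  by apply: measurableI => //; case: b => //; exact: measurableC.
have -> : pr P F = pr P [set w | (ZF w).2].
  by congr (pr P); apply/seteqP; split => w /= /asboolP.
rewrite (pr_sum_fibers P (fun z => z.2) mZF).
transitivity (\sum_(z | xpredT z.1 && z.2) pr P [set w | ZF w = (z.1, z.2)]).
  by apply: eq_bigr => -[].
rewrite -(pair_big_dep xpredT (fun _ b => b)
  (fun z b => pr P [set w | ZF w = (z, b)]))/=.
apply: eq_bigr => z _; rewrite (big_pred1 true); last by case.
congr (pr P); apply/seteqP; rewrite /ZF; split => w /=.
  by move=> [-> /asboolP].
by move=> [-> /asboolT ->].
Qed.

End FiniteInformation.

(** * L1 distances of conditional probabilities *)

Section RealIntegral.
Context d (T : measurableType d) (R : realType) (P : probability T R).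

Local Notation intg f := (P.-integrable setT (EFin \o f)).

Lemma integrable_subset (f : T -> R) D : measurable D -> intg f ->
  P.-integrable D (EFin \o f).
Proof. by move=> mD; apply: integrableS. Qed.

Lemma integrable_sub (f g : T -> R) : intg f -> intg g -> intg (fun w => f w - g w).
Proof. by move=> If Ig; have := integrableB measurableT If Ig. Qed.

Lemma integrable_dist (f g : T -> R) : intg f -> intg g ->
  intg (fun w => `|f w - g w|).
Proof. by move=> If Ig; exact: (integrable_norm (integrable_sub If Ig)). Qed.

Lemma Rintegral_setC (f : T -> R) B : measurable B -> intg f ->
  \int[P]_(w in setT) f w = \int[P]_(w in B) f w + \int[P]_(w in ~` B) f w.
Proof.
move=> mB If; rewrite -Rintegral_setU ?setUv//; first exact: measurableC.
by apply/eqP; rewrite setICr.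
Qed.

Lemma le_Rintegral_subset (f g : T -> R) D : measurable D -> intg f -> intg g ->
  (forall w, D w -> f w <= g w) ->
  \int[P]_(w in D) f w <= \int[P]_(w in D) g w.
Proof. by move=> mD If Ig; apply: le_Rintegral => //; exact: integrable_subset. Qed.

Lemma Rintegral_sub (f g : T -> R) D : measurable D -> intg f -> intg g ->
  \int[P]_(w in D) (f w - g w) =
  \int[P]_(w in D) f w - \int[P]_(w in D) g w.
Proof. by move=> mD If Ig; apply: RintegralB => //; exact: integrable_subset. Qed.

Lemma dist_Rintegral_triangle (f g h : T -> R) : intg f -> intg g -> intg h ->
  \int[P]_(w in setT) `|f w - h w| <=
  \int[P]_(w in setT) `|f w - g w| + \int[P]_(w in setT) `|g w - h w|.
Proof.
move=> If Ig Ih; rewrite -RintegralD//; [|exact: integrable_dist..].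
apply: le_Rintegral => //; first exact: integrable_dist.
  exact: (integrableD measurableT (integrable_dist If Ig) (integrable_dist Ig Ih)).
by move=> w _; exact: ler_distD.
Qed.

(* Replacing f by its conditional expectation a decreases the L1 distance to
   every b for which the set B is an event of the conditioning sigma-algebra. *)
Lemma dist_Rintegral_project (f a b : T -> R) e :
  intg f -> intg a -> intg b -> let B := [set w | b w <= a w] in
  measurable B ->
  `|\int[P]_(w in B) a w - \int[P]_(w in B) f w| <= e ->
  `|\int[P]_(w in ~` B) a w - \int[P]_(w in ~` B) f w| <= e ->
  \int[P]_(w in setT) `|a w - b w| <=
    \int[P]_(w in setT) `|f w - b w| + 2 * e.
Proof.
move=> If Ia Ib B mB H1 H2.
have mB' := measurableC mB.
have Iab := integrable_dist Ia Ib.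
have Ifb := integrable_dist If Ib.
rewrite (Rintegral_setC mB Iab) (Rintegral_setC mB Ifb).
have -> : \int[P]_(w in B) `|a w - b w| = \int[P]_(w in B) (a w - b w).
  by apply: eq_Rintegral => w; rewrite inE /B /= => ab; rewrite ger0_norm// subr_ge0.
have -> : \int[P]_(w in ~` B) `|a w - b w| = \int[P]_(w in ~` B) (b w - a w).
  apply: eq_Rintegral => w; rewrite inE /B /= => /negP; rewrite -ltNge => ab.
  by rewrite distrC gtr0_norm// subr_gt0.
rewrite !Rintegral_sub//.
have : \int[P]_(w in B) (f w - b w) <= \int[P]_(w in B) `|f w - b w|.
  apply: le_Rintegral_subset => //; first exact: integrable_sub.
  by move=> w _; exact: ler_norm.
have : \int[P]_(w in ~` B) (b w - f w) <= \int[P]_(w in ~` B) `|f w - b w|.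
  apply: le_Rintegral_subset => //; first exact: integrable_sub.
  by move=> w _; rewrite distrC; exact: ler_norm.
rewrite !Rintegral_sub//.
move: H1 H2; rewrite !ler_norml => /andP[? ?] /andP[? ?] ? ?; lra.
Qed.

Lemma cond_prob_Rintegral (G : set (set T)) E (f : T -> R) D :
  is_cond_prob P G E f -> G D -> \int[P]_(w in D) f w = pr P (E `&` D).
Proof. by move=> [_ _ H] GD; rewrite /Rintegral H. Qed.

Lemma cond_prob_integrable (G : set (set T)) E (f : T -> R) :
  is_cond_prob P G E f -> intg f.
Proof. by case. Qed.

(** Conditioning is an L1 contraction: [g] is no farther from [h] than [f] is, and [h] is no farther
    from [u] than [f] is, up to 2 e, since [h] integrates almost like [f] on the comparison set.
    Each of the two triangle inequalities doubles a distance, whence the factor 4. *)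
Lemma Rintegral_cond_prob_dist (G H : set (set T)) E (f g h u : T -> R) e :
  G `<=` measurable -> H `<=` G ->
  is_cond_prob P G E f -> is_cond_prob P H E g -> intg h -> intg u ->
  (let B := [set w | h w <= g w] in H B /\ H (~` B)) ->
  (let B := [set w | u w <= h w] in [/\ G B, G (~` B),
    `|\int[P]_(w in B) h w - pr P (E `&` B)| <= e &
    `|\int[P]_(w in ~` B) h w - pr P (E `&` ~` B)| <= e]) ->
  \int[P]_(w in setT) `|f w - g w| <=
    4 * \int[P]_(w in setT) `|f w - u w| + 4 * e.
Proof.
move=> mG HG cf cg Ih Iu /= [HB HB'] [GB GB' H1 H2].
have If := cond_prob_integrable cf; have Ig := cond_prob_integrable cg.
have K1 := @dist_Rintegral_project f g h 0 If Ig Ih (mG _ (HG _ HB)).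
have K2 := @dist_Rintegral_project f h u e If Ih Iu (mG _ GB).
rewrite !(cond_prob_Rintegral cf)// in K2.
rewrite !(cond_prob_Rintegral cf) in K1; [|exact: HG..].
rewrite !(cond_prob_Rintegral cg)// in K1.
rewrite !subrr normr0 lexx mulr0 addr0 in K1.
have T1 := dist_Rintegral_triangle If Ih Ig.
have T2 := dist_Rintegral_triangle If Iu Ih.
have sw (a b : T -> R) : \int[P]_(w in setT) `|a w - b w| =
    \int[P]_(w in setT) `|b w - a w|.
  by apply: eq_Rintegral => w _; rewrite distrC.
have := K1 isT isT; have := K2 H1 H2.
by rewrite (sw g h) (sw h u) => ? ?; lra.
Qed.

End RealIntegral.

(** * Approximation of a conditional probability by step functions *)

Section ApproxCondProb.
Context d (T : measurableType d) (R : realType) (P : probability T R).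

Local Notation intg f := (P.-integrable setT (EFin \o f)).

Lemma integrable_indic_sum (I : Type) (s : seq I) (c : I -> R) (F : I -> set T) :
  (forall i, measurable (F i)) ->
  intg (fun w => \sum_(i <- s) c i * \1_(F i) w).
Proof.
move=> mF; have -> : EFin \o (fun w => \sum_(i <- s) c i * \1_(F i) w) =
    (fun w => (\sum_(i <- s) (c i)%:E * (\1_(F i) w)%:E)%E).
  by apply/funext => w /=; rewrite -sumEFin.
apply: integrable_sum => // i _.
by apply: integrableZl => //; exact: integrable_indic.
Qed.

Lemma Rintegral_indic_sum (I : Type) (s : seq I) (c : I -> R) (F : I -> set T)
    D : (forall i, measurable (F i)) -> measurable D ->
  \int[P]_(w in D) (\sum_(i <- s) c i * \1_(F i) w) =
  \sum_(i <- s) c i * pr P (F i `&` D).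
Proof.
move=> mF mD; elim: s => [|i s IH].
  rewrite big_nil (@eq_Rintegral _ _ _ _ _ (cst 0)); last first.
    by move=> w _; rewrite big_nil.
  by rewrite Rintegral_cst// mul0r.
rewrite big_cons -IH (@eq_Rintegral _ _ _ _ _ (fun w => c i * \1_(F i) w +
    \sum_(i <- s) c i * \1_(F i) w)); last by move=> w _; rewrite big_cons.
have Ii : intg (\1_(F i) : T -> R) by exact: integrable_indic.
have Ici : intg (fun w => c i * \1_(F i) w : R).
  by have := integrableZl measurableT (c i) Ii.
rewrite RintegralD//.
- rewrite RintegralZl//; last exact: integrable_subset.
  by congr (_ * _ + _); rewrite /Rintegral integral_indic.
- exact: integrable_subset.
- by apply: integrable_subset => //; exact: integrable_indic_sum.
Qed.

Lemma sum_ltn_minn n m : \sum_(i < n) (i < m)%N%:R = (minn n m)%:R :> R.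
Proof.
elim: n => [|n IH]; first by rewrite big_ord0 min0n.
rewrite big_ord_recr/= IH -natrD; congr _%:R.
by rewrite /minn; case: ltnP; case: (ltnP n.+1 m); lia.
Qed.

Lemma Rintegral_setDI (f : T -> R) D B : measurable D -> measurable B -> intg f ->
  \int[P]_(w in D) f w =
  \int[P]_(w in D `&` B) f w + \int[P]_(w in D `\` B) f w.
Proof.
move=> mD mB If; rewrite -Rintegral_setU ?setUIDK//.
- exact: measurableI.
- exact: measurableD.
- exact: integrable_subset.
- by apply/eqP; rewrite setDE setIACA setICr setI0.
Qed.

(** Layer cake: for f in [0, 1] the mean of the indicators of the N levels f >= (i+1)/N is f rounded
    down to a multiple of 1/N. Each level is then replaced by an event of A. A version f may leave
    [0, 1], but the sets f < 0 and f > 1 are in G, and there the integral of f lies between 0 and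
    the probability of the set, so they contribute nothing. *)
Lemma cond_prob_approx (G A : set (set T)) E (f : T -> R) e :
  measurable E -> G `<=` measurable -> is_cond_prob P G E f ->
  (forall C, A C -> measurable C) ->
  (forall B, G B -> forall delta, 0 < delta ->
    exists2 C, A C & pr P (B `+` C) <= delta) ->
  0 < e -> exists n (C : nat -> set T), (forall i, A (C i)) /\
    \int[P]_(w in setT) `|f w - \sum_(i < n.+1) n.+1%:R^-1 * \1_(C i) w| <= e.
Proof.
move=> mE mG cf mA aG e0; have [Gf If _] := cf.
have e20 : 0 < e / 2 by rewrite divr_gt0.
pose n := Num.trunc (e / 2)^-1.
set N : R := n.+1%:R; have N0 : 0 < N by rewrite ltr0n.
have Ne : N^-1 <= e / 2.
  by rewrite -[e / 2]invrK lef_pV2 ?posrE ?invr_gt0// ltW// truncnS_gt.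
pose B i := [set w | i.+1%:R / N <= f w].
have GB i : G (B i).
  have -> : B i = f @^-1` `[i.+1%:R / N, +oo[%classic.
    by apply/seteqP; split => w /=; rewrite in_itv/= andbT.
  exact: Gf.
have mB i : measurable (B i) by exact/mG/GB.
have [C HC] : exists C : nat -> set T, forall i,
    A (C i) /\ pr P (B i `+` C i) <= e / 2.
  have /choice[C HC] : forall i, exists C, A C /\ pr P (B i `+` C) <= e / 2.
    by move=> i; have [C ? ?] := aG _ (GB i) _ e20; exists C.
  by exists C.
have mC i : measurable (C i) by exact: mA (HC i).1.
exists n, C; split; first by move=> i; case: (HC i).
pose u F w : R := \sum_(i < n.+1) N^-1 * \1_(F i : set T) w.
have Iu F : (forall i, measurable (F i)) -> intg (u F).
  by move=> mF; exact: integrable_indic_sum.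
have mY i : measurable (B i `+` C i) by exact: measurable_setY.
have IuB := Iu _ mB; have IuC := Iu _ mC; have IuY := Iu _ mY.
apply: (@le_trans _ _ (\int[P]_(w in setT) `|f w - u B w| +
    \int[P]_(w in setT) `|u B w - u C w|)).
  exact: dist_Rintegral_triangle.
have uBE w : u B w = (minn n.+1 (Num.trunc (N * f w)))%:R / N.
  rewrite /u -mulr_sumr -sum_ltn_minn mulrC; congr (_ * _).
  apply: eq_bigr => i _; rewrite indicE; congr (nat_of_bool _)%:R.
  rewrite truncn_gt_nat; apply/idP/idP.
    by rewrite inE /B /= ler_pdivrMr// mulrC.
  by rewrite mulrC -ler_pdivrMr// => H; rewrite inE.
rewrite [leRHS]splitr; apply: lerD; last first.
  apply: (@le_trans _ _ (\int[P]_(w in setT) u (fun i => B i `+` C i) w)).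
    apply: le_Rintegral_subset => //; first exact: integrable_dist.
    move=> w _; rewrite /u -sumrB; apply: (le_trans (ler_norm_sum _ _ _)).
    apply: ler_sum => i _; rewrite -mulrBr normrM ger0_norm ?invr_ge0 ?(ltW N0)//.
    rewrite ler_pM2l ?invr_gt0// !indicE.
    have [Bw|Bw] := pselect (B i w); have [Cw|Cw] := pselect (C i w).
    - by rewrite (mem_set Bw) (mem_set Cw) subrr normr0.
    - rewrite (mem_set Bw) (memNset Cw) subr0 normr1 mem_set//.
      by left.
    - rewrite (memNset Bw) (mem_set Cw) sub0r normrN normr1 mem_set//.
      by right.
    - by rewrite (memNset Bw) (memNset Cw) subrr normr0.
  rewrite Rintegral_indic_sum//.
  apply: (@le_trans _ _ (\sum_(i < n.+1) N^-1 * (e / 2))).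
    by apply: ler_sum => i _; rewrite ler_pM2l ?invr_gt0// setIT; case: (HC i).
  rewrite sumr_const card_ord -(mulr_natl _ n.+1) -/N mulrA mulfV ?mul1r//.
  by rewrite gt_eqF.
apply: le_trans Ne.
pose B1 := [set w | f w < 0]; pose B2 := [set w | 1 < f w].
have GB1 : G B1.
  have -> : B1 = f @^-1` `]-oo, 0[%classic.
    by apply/seteqP; split => w /=; rewrite in_itv.
  exact: Gf.
have GB2 : G B2.
  have -> : B2 = f @^-1` `]1, +oo[%classic.
    by apply/seteqP; split => w /=; rewrite in_itv/= andbT.
  exact: Gf.
have mB1 := mG _ GB1; have mB2 := mG _ GB2.
have Ik := integrable_dist If IuB.
rewrite (Rintegral_setC mB1 Ik) (Rintegral_setDI (measurableC mB1) mB2 Ik).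
have -> : ~` B1 `&` B2 = B2.
  apply/setIidr => w; rewrite /B1 /B2 /= => f1; apply/negP; rewrite -leNgt.
  by rewrite (le_trans ler01)// ltW.
have H1 : \int[P]_(w in B1) `|f w - u B w| <= 0.
  have -> : \int[P]_(w in B1) `|f w - u B w| = \int[P]_(w in B1) (0 - f w).
    apply: eq_Rintegral => w; rewrite inE /B1 /= => f0; rewrite uBE.
    have -> : Num.trunc (N * f w) = 0%N.
      apply/truncn0Pn; rewrite -ltNge (@lt_trans _ _ 0)// pmulr_rlt0//.
    by rewrite minn0 mul0r subr0 sub0r ltr0_norm.
  rewrite Rintegral_sub//; last exact: finite_measure_integrable_cst.
  rewrite Rintegral_cst// mul0r sub0r (cond_prob_Rintegral cf GB1).
  by rewrite oppr_le0; exact: pr_ge0.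
have H2 : \int[P]_(w in B2) `|f w - u B w| <= 0.
  have -> : \int[P]_(w in B2) `|f w - u B w| = \int[P]_(w in B2) (f w - 1).
    apply: eq_Rintegral => w; rewrite inE /B2 /= => f1; rewrite uBE.
    have /minn_idPl -> : (n.+1 <= Num.trunc (N * f w))%N.
      by rewrite truncn_gt_nat -/N ler_peMr// ltW.
    by rewrite divff ?gt_eqF// gtr0_norm// subr_gt0.
  rewrite Rintegral_sub//; last exact: finite_measure_integrable_cst.
  rewrite Rintegral_cst// mul1r (cond_prob_Rintegral cf GB2) subr_le0.
  by apply: le_pr => //; exact: measurableI.
have H3 : \int[P]_(w in ~` B1 `\` B2) `|f w - u B w| <= N^-1.
  have mD : measurable (~` B1 `\` B2).
    by apply: measurableD => //; exact: measurableC.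
  apply: (@le_trans _ _ (\int[P]_(w in ~` B1 `\` B2) N^-1)).
    apply: le_Rintegral_subset => //; first exact: finite_measure_integrable_cst.
    move=> w; rewrite /B1 /B2 /= => -[/negP]; rewrite -leNgt => f0 /negP.
    rewrite -leNgt => f1; rewrite uBE.
    have Nf0 : 0 <= N * f w by rewrite mulr_ge0// ltW.
    have /andP[t1 t2] := truncn_itv Nf0.
    have /minn_idPr -> : (Num.trunc (N * f w) <= n.+1)%N.
      by rewrite -(ler_nat R) (le_trans t1)// -/N ler_piMr// ltW.
    have -> : f w - (Num.trunc (N * f w))%:R / N =
        (N * f w - (Num.trunc (N * f w))%:R) * N^-1.
      by field; rewrite gt_eqF.
    rewrite ger0_norm.
      by rewrite ler_piMl ?invr_ge0 ?(ltW N0)//; move: t2; rewrite -natr1; lra.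
    by rewrite mulr_ge0 ?subr_ge0// invr_ge0 ltW.
  rewrite Rintegral_cst// ler_piMr ?invr_ge0 ?(ltW N0)//.
  exact: pr_le1.
by apply: (le_trans (lerD H1 (lerD H2 H3))); rewrite !add0r.
Qed.

End ApproxCondProb.

(** * The law of the model in a finite box *)

Section SignLaw.
Context d (T : measurableType d) (R : realType) (P : probability T R).

Lemma bigsetIE (I : eqType) (s : seq I) (F : I -> set T) :
  \big[setI/setT]_(i <- s) F i = [set w | forall i, i \in s -> F i w].
Proof.
elim: s => [|i s IH]; first by rewrite big_nil; apply/seteqP; split.
rewrite big_cons IH; apply/seteqP; split => w /=.
  by move=> [Fi Fs] j; rewrite inE => /predU1P[->//|]; exact: Fs.
move=> Fs; split; first by apply: Fs; rewrite mem_head.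
by move=> j js; apply: Fs; rewrite inE js orbT.
Qed.

Lemma prod_EFin (I : Type) (s : seq I) (f : I -> R) :
  (\prod_(i <- s) (f i)%:E)%E = (\prod_(i <- s) f i)%:E.
Proof.
by elim: s => [|i s IH]; rewrite ?big_nil// !big_cons IH EFinM.
Qed.

(** The second conclusion is what makes the independence of the signal and noise sigma-algebras
    applicable in [finite_law]. *)
Lemma sign_law (I' : choiceType) (F : I' -> T -> R) (q : bool -> R)
    (I : finType) (iota : I -> I') (x : I -> bool) :
  mutually_independent P F ->
  (forall i b, P [set w | (F i w == -1) = b] = (q b)%:E) ->
  injective iota ->
  let A := [set w | forall i, (F (iota i) w == -1) = x i] in
  P A = (\prod_i q (x i))%:E /\ <<s gen_events F setT >> A.
Proof.
move=> Find Fq iota_inj A.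
pose B i' : set R := if [pick i | iota i == i'] is Some i
  then [set r | (r == -1) = x i] else setT.
have BE i : B (iota i) = [set r | (r == -1) = x i].
  rewrite /B; case: pickP => [j /eqP/iota_inj ->//|/(_ i)].
  by rewrite eqxx.
have mB i' : measurable (B i').
  rewrite /B; case: pickP => // i _; case: (x i).
    have -> : [set r : R | (r == -1) = true] = [set -1].
      by apply/seteqP; split => r /= /eqP.
    exact: measurable_set1.
  have -> : [set r : R | (r == -1) = false] = ~` [set -1].
    by apply/seteqP; split => r /= /eqP// /negbTE.
  by apply: measurableC; exact: measurable_set1.
have AE : A = \big[setI/setT]_(i' <- map iota (enum I)) F i' @^-1` B i'.
  rewrite bigsetIE; apply/seteqP; split => w /=.
    by move=> H i' /mapP[i _ ->]; rewrite BE.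
  move=> H i; have := H (iota i); rewrite BE; apply.
  by apply: map_f; rewrite mem_enum.
split.
  rewrite AE Find//; last by rewrite map_inj_uniq// enum_uniq.
  rewrite big_map big_enum/=.
  by rewrite -prod_EFin; apply: eq_bigr => i _; rewrite BE Fq.
rewrite AE; apply: (@bigsetI_measurable _ (g_sigma_algebraType (gen_events F setT))).
move=> i' _; apply: sub_sigma_algebra; exists i' => //.
by exists (B i') => //; rewrite setTI.
Qed.

End SignLaw.

Lemma sign_neq (R : realType) : (1 == -1 :> R) = false.
Proof. by apply/negbTE; rewrite gt_eqF// (@lt_trans _ _ 0)// oppr_lt0. Qed.

Lemma sign_mul3 (R : realType) (a b c : R) : (a = 1 \/ a = -1) ->
  (b = 1 \/ b = -1) -> (c = 1 \/ c = -1) ->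
  (a * b * c == -1) = (c == -1) (+) (b == -1) (+) (a == -1).
Proof.
by move=> [->|->] [->|->] [->|->];
  rewrite ?(mulrN1, mulr1, opprK) ?eqxx ?sign_neq.
Qed.

Lemma addb2K (a b c : bool) : a (+) b (+) c (+) b (+) c = a.
Proof. by case: a; case: b; case: c. Qed.

Section Model.
Context d (T : measurableType d) (R : realType) (P : probability T R) (p : R).
Variables (X xib xih : int -> int -> {RV P >-> R}).
Hypothesis model : filter_model p X xib xih.

Definition xneg (j v : int) (w : T) : bool := X j v w == -1.
Definition ybneg (j v : int) (w : T) : bool := Ybar X xib (j, v) w == -1.
Definition yhneg (j v : int) (w : T) : bool := Yhat X xih (j, v) w == -1.
Definition nneg (i : (int * int) + (int * int)) (w : T) : bool :=
  noise xib xih i w == -1.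

Definition wgt (b : bool) : R := if b then p else 1 - p.

Lemma measurable_pre_eq (F : {RV P >-> R}) (r : R) b :
  measurable [set w | (F w == r) = b].
Proof.
have mr : measurable [set w | F w = r].
  have := measurable_funPT F measurableT [set r] (measurable_set1 r).
  by rewrite setTI.
case: b.
  have -> // : [set w | (F w == r) = true] = [set w | F w = r].
  by apply/seteqP; split => w /= /eqP.
have -> : [set w | (F w == r) = false] = ~` [set w | F w = r].
  by apply/seteqP; split => w /= /eqP// /negbTE.
exact: measurableC.
Qed.

Lemma signal_sign j v w : X j v w = 1 \/ X j v w = -1.
Proof. by case: model => -[H _] _ _ _ _; exact: (H (j, v)). Qed.

Lemma noise_sign i w : noise xib xih i w = 1 \/ noise xib xih i w = -1.
Proof. by case: model => _ [H _] _ _ _; exact: H. Qed.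

Lemma signal_negb i b : P [set w | (signal X i w == -1) = b] = (1 / 2)%:E.
Proof.
have [[_ H] _ _ _ _] := model; have {}H := H i.
have E0 : [set w | (signal X i w == -1) = false] = signal X i @^-1` [set 1].
  apply/seteqP; split => w /=; rewrite /signal.
    by case: (signal_sign i.1 i.2 w) => ->; rewrite ?eqxx.
  by move=> ->; rewrite sign_neq.
case: b; last by rewrite E0.
have -> : [set w | (signal X i w == -1) = true] =
    ~` [set w | (signal X i w == -1) = false].
  by apply/seteqP; split => w /=; case: (_ == _).
rewrite probability_setC; last exact: measurable_pre_eq.
by rewrite E0 H -EFinB; congr EFin; lra.
Qed.

Lemma noise_negb i b : P [set w | (noise xib xih i w == -1) = b] = (wgt b)%:E.
Proof.
have [_ [_ H] _ _ _] := model; have {}H := H i.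
have E1 : [set w | (noise xib xih i w == -1) = true] =
    noise xib xih i @^-1` [set -1].
  by apply/seteqP; split => w /= /eqP.
case: b; first by rewrite E1.
have -> : [set w | (noise xib xih i w == -1) = false] =
    ~` [set w | (noise xib xih i w == -1) = true].
  by apply/seteqP; split => w /=; case: (_ == _).
rewrite probability_setC; first by rewrite E1 H -EFinB.
by case: i {H E1} => i; exact: measurable_pre_eq.
Qed.

Lemma finite_law (I J : finType) (iota : I -> int * int)
    (kappa : J -> (int * int) + (int * int)) (x : I -> bool) (eta : J -> bool) :
  injective iota -> injective kappa ->
  pr P [set w | (forall i, xneg (iota i).1 (iota i).2 w = x i) /\
                (forall j, nneg (kappa j) w = eta j)] =
  (1 / 2) ^+ #|I| * \prod_j wgt (eta j).
Proof.
move=> iotaI kappaI; have [_ _ Xind Nind XN] := model.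
have [PA SA] := sign_law x Xind signal_negb iotaI.
have [PB SB] := sign_law eta Nind noise_negb kappaI.
have H := XN _ _ SA SB; rewrite PA PB prodr_const -EFinM in H.
exact: (congr1 fine H).
Qed.

Lemma pr_noise_all (J : finType) (kappa : J -> (int * int) + (int * int)) :
  injective kappa -> pr P [set w | forall j, nneg (kappa j) w] = p ^+ #|J|.
Proof.
move=> kappaI.
have := @finite_law void J (fun v => match v with end) kappa
  (fun v => match v with end) xpredT (fun v => match v with end) kappaI.
rewrite card_void expr0 mul1r prodr_const => <-.
by congr (pr P); apply/seteqP; split => w /=; [move=> H; split => [[]|]|case].
Qed.

Lemma measurable_xneg j v : measurable [set w | xneg j v w].
Proof. exact: (measurable_pre_eq (X j v) (-1) true). Qed.

Lemma measurable_nneg i : measurable [set w | nneg i w].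
Proof. by case: i => i; exact: (measurable_pre_eq _ (-1) true). Qed.

Lemma ybnegE j v w :
  ybneg j v w = nneg (inl (j, v)) w (+) xneg (j - 1) v w (+) xneg j v w.
Proof.
rewrite /ybneg /Ybar sign_mul3//; [exact: signal_sign..|].
exact: (noise_sign (inl (j, v))).
Qed.

Lemma yhnegE j v w :
  yhneg j v w = nneg (inr (j, v)) w (+) xneg j (v + 1) w (+) xneg j v w.
Proof.
rewrite /yhneg /Yhat sign_mul3//; [exact: signal_sign..|].
exact: (noise_sign (inr (j, v))).
Qed.

Section Box.
Variables k n M : nat.
Notation V := ('I_k.+1 * 'I_n.+1)%type.
Notation E := (('I_k * 'I_n) + ('I_k * 'I_n))%type.

Definition site (c : nat) : int := c%:Z - M%:Z.

(** There are n columns of observations but n+1 columns of sites, because [Yhat] in the last column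
    looks at the next site. The index j of an edge stands for an observation at time j+1. *)
Definition src (e : E) : V :=
  match e with
  | inl (j, c) => (widen_ord (leqnSn k) j, widen_ord (leqnSn n) c)
  | inr (j, c) => (lift ord0 j, widen_ord (leqnSn n) c)
  end.

Definition tgt (e : E) : V :=
  match e with
  | inl (j, c) => (lift ord0 j, widen_ord (leqnSn n) c)
  | inr (j, c) => (lift ord0 j, lift ord0 c)
  end.

Definition xbox (w : T) : {ffun V -> bool} :=
  [ffun v : V => xneg (v.1 : nat)%:Z (site v.2) w].

Definition ybox (w : T) : {ffun E -> bool} :=
  [ffun e : E => match e with
   | inl (j, c) => ybneg (j : nat).+1%:Z (site c) w
   | inr (j, c) => yhneg (j : nat).+1%:Z (site c) w
   end].

Definition noise_index (e : E) : (int * int) + (int * int) :=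
  match e with
  | inl (j, c) => inl ((j : nat).+1%:Z, site c)
  | inr (j, c) => inr ((j : nat).+1%:Z, site c)
  end.

Lemma yboxE w e : ybox w e =
  nneg (noise_index e) w (+) xbox w (src e) (+) xbox w (tgt e).
Proof.
rewrite !ffunE; case: e => [[j c]|[j c]] /=; rewrite /bump !leq0n !add1n.
  rewrite ybnegE; congr (_ (+) xneg _ _ _ (+) _).
  by rewrite intS addrAC subrr add0r.
rewrite yhnegE addbAC; congr (_ (+) _ (+) xneg _ _ _).
by rewrite /site intS; lia.
Qed.

(** Up to the factor (1/2)^|V| this is the joint law of signal and observations: once x and y are
    fixed, the noise on e is forced to be y plus the coboundary of x. *)
Definition gibbs (y : {ffun E -> bool}) (x : {ffun V -> bool}) : R :=
  \prod_e wgt (y e (+) x (src e) (+) x (tgt e)).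

Lemma box_fiber y x : pr P [set w | xbox w = x /\ ybox w = y] =
  (1 / 2) ^+ #|{: V}| * gibbs y x.
Proof.
rewrite /gibbs -(@finite_law _ _
  (fun v : V => ((v.1 : nat)%:Z, site v.2)) noise_index x).
- congr (pr P); apply/seteqP; split => w /=.
    move=> [<- <-]; split => [v|e]; first by rewrite ffunE.
    by rewrite yboxE addb2K.
  move=> [Hx Hn]; have xE : xbox w = x by apply/ffunP => v; rewrite ffunE Hx.
  split => //; apply/ffunP => e; rewrite yboxE Hn xE.
  by rewrite addb2K.
- move=> [j c] [j' c'] [/= jj cc]; congr pair; apply: val_inj => //=.
  by move: cc; rewrite /site => /addIr [].
- have pairI (j j' : 'I_k) (c c' : 'I_n) : (j : nat) = j' ->
      site c = site c' -> (j, c) = (j', c').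
    by move=> jj /addIr[cc]; congr pair; exact: val_inj.
  by move=> [[j c]|[j c]] [[j' c']|[j' c']]//= [jj cc]; rewrite (pairI _ _ _ _ jj cc).
Qed.

Lemma measurable_box y x : measurable [set w | xbox w = x /\ ybox w = y].
Proof.
pose z (i : V + E) w := match i with
  | inl v => xbox w v | inr e => nneg (noise_index e) w end.
apply: (@measurable_determined _ _ (V + E)%type z) => [[v|e]|w w' zz].
- rewrite /z; under eq_set do rewrite ffunE; exact: measurable_xneg.
- exact: measurable_nneg.
- have xE : xbox w = xbox w' by apply/ffunP => v; exact: (zz (inl v)).
  rewrite /=; suff -> : ybox w = ybox w' by rewrite xE.
  by apply/ffunP => e; rewrite !yboxE xE; congr (_ (+) _ (+) _); exact: (zz (inr e)).
Qed.

Lemma box_law y (chi : pred {ffun V -> bool}) :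
  pr P [set w | ybox w = y /\ chi (xbox w)] =
  (1 / 2) ^+ #|{: V}| * \sum_(x | chi x) gibbs y x.
Proof.
pose Z w := (xbox w, ybox w); pose C z := chi z.1 && (z.2 == y).
have -> : [set w | ybox w = y /\ chi (xbox w)] = [set w | C (Z w)].
  apply/seteqP; split => w; rewrite /C /=; first by move=> [-> ->]; rewrite eqxx.
  by case/andP => ? /eqP.
rewrite pr_sum_fibers /C /Z.
  transitivity (\sum_(z | chi z.1 && (z.2 == y))
      pr P [set w | (xbox w, ybox w) = (z.1, z.2)]).
    by apply: eq_bigr => -[x z].
  rewrite -(pair_big_dep chi (fun _ z => z == y)
    (fun x z => pr P [set w | (xbox w, ybox w) = (x, z)]))/=.
  rewrite mulr_sumr; apply: eq_bigr => x _; rewrite big_pred1_eq -box_fiber.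
  by congr (pr P); apply/seteqP; split => w /= [-> ->].
move=> [x z]; have -> : [set w | (xbox w, ybox w) = (x, z)] =
    [set w | xbox w = x /\ ybox w = z].
  by apply/seteqP; split => w /= [-> ->].
exact: measurable_box.
Qed.

End Box.
End Model.

(** * Decay of correlations in a box *)

Section Grid.
Variables (R : realType) (p : R) (k n : nat).
Hypothesis p_gt : 49 / 100 < p.
Hypothesis p_le : p <= 1 / 2.
Notation V := ('I_k.+1 * 'I_n.+1)%type.
Notation E := (('I_k * 'I_n) + ('I_k * 'I_n))%type.
Variable y : {ffun E -> bool}.

Definition joins (e : E) (u v : V) : bool :=
  (src e == u) && (tgt e == v) || (src e == v) && (tgt e == u).

Definition adjacent (v u : V) : bool := [exists e, joins e v u].

Lemma wgt_gt0 b : 0 < wgt p b.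
Proof. by case: b; rewrite /wgt; have := p_gt; have := p_le; lra. Qed.

Lemma gibbs_gt0 x : 0 < gibbs p y x.
Proof. by apply: prodr_gt0 => e _; exact: wgt_gt0. Qed.

Lemma src_tgt_nat (e : E) :
  ((tgt e).1 : nat, (tgt e).2 : nat) = ((src e).1.+1, (src e).2 : nat) \/
  ((tgt e).1 : nat, (tgt e).2 : nat) = ((src e).1 : nat, (src e).2.+1).
Proof. by case: e => -[j c]; [left|right]; rewrite /= /bump !leq0n !add1n. Qed.

Lemma src_neq_tgt (e : E) : src e != tgt e.
Proof.
apply/eqP => st; have := src_tgt_nat e; rewrite -st => -[[]|[]].
  by move/eqP; rewrite ltn_eqF.
by move/eqP; rewrite ltn_eqF.
Qed.

Lemma src_tgt_inj (e e' : E) : src e = src e' -> tgt e = tgt e' -> e = e'.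
Proof.
case: e => -[j c]; case: e' => -[j' c'] [/= s1 s2] [/= t1 t2].
- by congr (inl (_, _)); apply: val_inj; move: s1 s2.
- by move: s1 t1; rewrite /bump !leq0n !add1n; lia.
- by move: s1 t1; rewrite /bump !leq0n !add1n; lia.
- by congr (inr (_, _)); apply: val_inj.
Qed.

(** The target of an edge is one step ahead of its source in exactly one coordinate, so two sites
    determine the edge. Hence a single factor of [gibbs] couples two neighbours. *)
Lemma joins_inj (u v : V) e e' : joins e u v -> joins e' u v -> e = e'.
Proof.
move=> /orP[|] /andP[/eqP s /eqP t] /orP[|] /andP[/eqP s' /eqP t'].
- by apply: src_tgt_inj; rewrite ?s ?s' ?t ?t'.
- have := src_tgt_nat e; have := src_tgt_nat e'; rewrite s s' t t'.
  by move=> -[[? ?]|[? ?]] [[? ?]|[? ?]]; exfalso; lia.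
- have := src_tgt_nat e; have := src_tgt_nat e'; rewrite s s' t t'.
  by move=> -[[? ?]|[? ?]] [[? ?]|[? ?]]; exfalso; lia.
- by apply: src_tgt_inj; rewrite ?s ?s' ?t ?t'.
Qed.

Let wt e (x : {ffun V -> bool}) := wgt p (y e (+) x (src e) (+) x (tgt e)).

Let touch (u : V) (e : E) := (src e == u) (+) (tgt e == u).

Lemma edge_flip u e x :
  y e (+) flip u x (src e) (+) flip u x (tgt e) =
  y e (+) x (src e) (+) x (tgt e) (+) touch u e.
Proof.
rewrite !ffunE /touch; move: (y e) (x (src e)) (x (tgt e)) => a b c.
by case: (src e == u); case: (tgt e == u); case: a; case: b; case: c.
Qed.

Lemma touch_joins u v e : u != v -> touch u e && touch v e = joins e v u.
Proof.
move=> uv; rewrite /touch /joins.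
have both (w a b : V) : a != b -> ~~ ((w == a) && (w == b)).
  by apply: contra => /andP[/eqP <- /eqP <-].
have stw w : ~~ ((src e == w) && (tgt e == w)).
  by apply: contra (src_neq_tgt e) => /andP[/eqP -> /eqP ->].
have := both (src e) _ _ uv; have := both (tgt e) _ _ uv.
have := stw u; have := stw v.
by case: (src e == u); case: (src e == v); case: (tgt e == u);
  case: (tgt e == v).
Qed.

Lemma wt_far u v e x : u != v -> ~~ joins e v u ->
  wt e x * wt e (flip u (flip v x)) = wt e (flip u x) * wt e (flip v x).
Proof.
move=> uv; rewrite -(touch_joins e uv) /wt !edge_flip negb_and.
case: (touch u e); case: (touch v e) => //= _; rewrite ?addbF// mulrC//.
Qed.

Lemma gibbs_far (u v : V) x : u != v -> ~~ adjacent v u ->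
  gibbs p y x * gibbs p y (flip u (flip v x)) =
  gibbs p y (flip u x) * gibbs p y (flip v x).
Proof.
move=> uv /existsPn vu; rewrite -!big_split/=; apply: eq_bigr => e _.
exact: wt_far.
Qed.

(** All factors but that of the common edge agree, and this one compares p^2 with (1 - p)^2. The
    difference is 1 - 2 p < 1/50 in absolute value and the sum is at least 1/2, so the ratio is
    below 1/25 and within the required 1/16. *)
Lemma gibbs_near (u v : V) x : u != v -> adjacent v u ->
  `|gibbs p y x * gibbs p y (flip u (flip v x)) -
    gibbs p y (flip u x) * gibbs p y (flip v x)| <=
  1 / 16 * (gibbs p y x * gibbs p y (flip u (flip v x)) +
    gibbs p y (flip u x) * gibbs p y (flip v x)).
Proof.
move=> uv /existsP[e evu]; rewrite -!big_split/=.
rewrite (bigD1 e)//= [\prod_i _](bigD1 e)//=.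
have -> : \prod_(i | i != e) (wt i x * wt i (flip u (flip v x))) =
    \prod_(i | i != e) (wt i (flip u x) * wt i (flip v x)).
  apply: eq_bigr => i ie; apply: wt_far => //; apply: contra ie => ivu.
  by apply/eqP; exact: joins_inj evu.
rewrite -!/(wt _ _); set r := \prod_(_ | _) _.
have r0 : 0 <= r.
  by apply: prodr_ge0 => i _; rewrite mulr_ge0// ltW// wgt_gt0.
rewrite -mulrBl -mulrDl normrM (ger0_norm r0) mulrA ler_wpM2r//.
have := touch_joins e uv; rewrite evu => /andP[tu tv].
rewrite /wt !edge_flip tu tv; have := p_gt; have := p_le.
case: (y e (+) x (src e) (+) x (tgt e)); rewrite /wgt /= ler_norml => ? ?;
  apply/andP; split; nra.
Qed.

(* A step towards time 0 at most doubles the weight, so an update spreads an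
   oscillation over 4 neighbours at a cost of at most 4 * (1 / 16) * 2 = 1 / 2;
   an oscillation that reaches time 0 has paid a factor 2 ^ k. *)
Definition level_weight (v : V) : R := 2 ^+ (k - v.1).

Lemma level_weight_ge1 v : 1 <= level_weight v.
Proof. by rewrite exprn_ege1// ler1n. Qed.

Lemma level_weight_adjacent (v : V) :
  \sum_(u | adjacent v u) 1 / 16 * level_weight u <= level_weight v / 2.
Proof.
pose c (u : V) := (u.1 : nat, u.2 : nat).
have cI : injective c.
  by move=> [a b] [a' b'] [/= ? ?]; congr pair; exact: val_inj.
(* On the border of the box some of these pairs name no site, or v itself since 0.-1 = 0; only the
   upper bound 4 matters. *)
pose nbs := [:: (v.1.+1, v.2 : nat); (v.1.-1, v.2 : nat);
               (v.1 : nat, v.2.+1); (v.1 : nat, v.2.-1)].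
have adj u : adjacent v u -> c u \in nbs.
  case/existsP => e /orP[] /andP[/eqP s /eqP t]; have := src_tgt_nat e;
    rewrite s t /c !inE !xpair_eqE => -[[-> ->]|[-> ->]]; rewrite ?eqxx ?orbT//=.
have : (#|[pred u | adjacent v u]| <= 4)%N.
  rewrite cardE -(size_map c); apply: (@uniq_leq_size _ _ nbs).
    by rewrite map_inj_uniq ?enum_uniq.
  by move=> _ /mapP[u + ->]; rewrite mem_enum inE => /adj.
move=> card4.
apply: (@le_trans _ _ (\sum_(u | adjacent v u) 1 / 16 * (2 * level_weight v))).
  apply: ler_sum => u /adj; rewrite /c !inE !xpair_eqE => uv.
  rewrite ler_pM2l; last lra.
  rewrite /level_weight -exprS ler_eXn2l ?ltr1n//.
  by move: uv; lia.
have lv0 : 0 <= level_weight v by rewrite (le_trans ler01)// level_weight_ge1.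
rewrite sumr_const -[X in X <= _]mulr_natl.
apply: (@le_trans _ _ (4%:R * (1 / 16 * (2 * level_weight v)))).
  by rewrite ler_wpM2r ?mulr_ge0// ler_nat.
by lra.
Qed.

Definition initial_site (v : V) : bool := (v.1 == 0 :> nat).

(** The oscillation of f starts on the sites of [S] at time k, which have weight 1, and the sites at
    time 0 have weight 2 ^ k: this is the quotient in the bound, which depends neither on n nor on
    y. *)
Lemma gibbs_decay (S : {pred 'I_n.+1}) (f : {ffun V -> bool} -> R)
    (Q Q' : pred {ffun V -> bool}) :
  (forall x, 0 <= f x <= 1) ->
  (forall x x' : {ffun V -> bool},
    (forall c, c \in S -> x (ord_max, c) = x' (ord_max, c)) -> f x = f x') ->
  bd_event initial_site Q -> bd_event initial_site Q' ->
  `|(\sum_(x | Q x) gibbs p y x * f x) * (\sum_(x | Q' x) gibbs p y x) -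
    (\sum_(x | Q x) gibbs p y x) * (\sum_(x | Q' x) gibbs p y x * f x)| <=
  #|S|%:R / 2 ^+ k * ((\sum_(x | Q x) gibbs p y x) * (\sum_(x | Q' x) gibbs p y x)).
Proof.
move=> f01 fS bQ bQ'.
pose b (v : V) : R := ((v.1 == ord_max) && (v.2 \in S))%:R.
have b0 v : 0 <= b v by rewrite /b ler0n.
have bf : osc_le b f.
  move=> v x; rewrite /b; have [vS|vS] := boolP (_ && _).
    by move: (f01 x) (f01 (flip v x)) => /andP[? ?] /andP[? ?];
      rewrite /= ler_norml; apply/andP; split; lra.
  rewrite (fS (flip v x) x) ?subrr ?normr0// => c cS.
  rewrite ffunE; have [vE|] := eqVneq (ord_max, c) v; last by rewrite addbF.
  by move: vS; rewrite -vE eqxx cS.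
have := @dobrushin_decay R _ (gibbs p y) (1 / 16) adjacent gibbs_gt0 _
  gibbs_far gibbs_near level_weight initial_site level_weight_ge1
  (fun v _ => level_weight_adjacent v) (2 ^+ k) b f Q Q' _ _ b0 bf bQ bQ'.
have -> : \sum_v level_weight v * b v = #|S|%:R.
  rewrite -(pair_bigA _ (fun j c => level_weight (j, c) * b (j, c)))/=.
  rewrite (bigD1 ord_max)//= [X in _ + X]big1 ?addr0; last first.
    move=> j jk; rewrite big1// => c _.
    by rewrite /b /= (negbTE jk) mulr0.
  rewrite -sum1_card natr_sum [RHS]big_mkcond; apply: eq_bigr => c _.
  rewrite /b /level_weight /= eqxx subnn expr0 mul1r /=.
  by case: (c \in S).
apply; first by lra.
  by rewrite exprn_gt0.
by move=> v /eqP v0; rewrite /level_weight v0 subn0.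
Qed.

End Grid.

(** * Finite windows *)

Section Windows.
Context d (T : measurableType d) (R : realType) (P : probability T R) (p : R).
Variables (X xib xih : int -> int -> {RV P >-> R}).
Hypothesis model : filter_model p X xib xih.

Definition agree_init (M : nat) (w w' : T) : Prop :=
  forall v : int, (absz v <= M)%N -> xneg X 0 v w = xneg X 0 v w'.

Definition agree_obs (k M : nat) (w w' : T) : Prop :=
  forall j v : int, 1 <= j <= k%:Z -> (absz v <= M)%N ->
    ybneg X xib j v w = ybneg X xib j v w' /\
    yhneg X xih j v w = yhneg X xih j v w'.

(** Finitely many bits decide such an event, so measurability follows from [measurable_determined].
    These events form an algebra, as the approximation of events requires. *)
Definition local_obs k : set (set T) := [set C | exists M, forall w w',
  agree_obs k M w w' -> C w -> C w'].

Definition local_init_obs k : set (set T) := [set C | exists M, forall w w',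
  agree_init M w w' -> agree_obs k M w w' -> C w -> C w'].

Lemma agree_init_sym M w w' : agree_init M w w' -> agree_init M w' w.
Proof. by move=> H v vM; rewrite H. Qed.

Lemma agree_obs_sym k M w w' : agree_obs k M w w' -> agree_obs k M w' w.
Proof. by move=> H j v jk vM; have [-> ->] := H j v jk vM. Qed.

Lemma agree_init_le M M' w w' : (M <= M')%N ->
  agree_init M' w w' -> agree_init M w w'.
Proof. by move=> MM H v vM; apply: H; exact: leq_trans MM. Qed.

Lemma agree_obs_le k M M' w w' : (M <= M')%N ->
  agree_obs k M' w w' -> agree_obs k M w w'.
Proof. by move=> MM H j v jk vM; apply: H => //; exact: leq_trans MM. Qed.

Lemma site_absz M v : (absz v <= M)%N ->
  site M (absz (v + M%:Z)%R) = v /\ (absz (v + M%:Z)%R < (2 * M).+1)%N.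
Proof. by rewrite /site => vM; split; lia. Qed.

Lemma agree_init_box k n M w w' : (2 * M <= n)%N ->
  (forall c : 'I_n.+1, xbox X k n M w (ord0, c) = xbox X k n M w' (ord0, c)) ->
  agree_init M w w'.
Proof.
move=> Mn H v vM; have [sv vn] := site_absz vM.
have vn' : (absz (v + M%:Z)%R < n.+1)%N by exact: (leq_trans vn).
by have := H (Ordinal vn'); rewrite !ffunE /= sv.
Qed.

(** The 2 M + 1 sites with |v| <= M must fit into the n columns of observations, hence 2 M < n; the
    initial row has one more column, hence 2 M <= n in [agree_init_box]. *)
Lemma agree_obs_box k n M w w' : (2 * M < n)%N ->
  ybox X xib xih k n M w = ybox X xib xih k n M w' -> agree_obs k M w w'.
Proof.
move=> Mn yy j v /andP[j1 jk] vM; have [sv vn] := site_absz vM.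
have vn' : (absz (v + M%:Z)%R < n)%N by exact: (leq_trans vn).
have jk' : ((absz j).-1 < k)%N by lia.
have jE : ((absz j).-1.+1)%:Z = j by lia.
have := congr1 (fun y : {ffun _} => y (inl (Ordinal jk', Ordinal vn'))) yy.
have := congr1 (fun y : {ffun _} => y (inr (Ordinal jk', Ordinal vn'))) yy.
by rewrite !ffunE /= jE sv.
Qed.

Lemma box_agree_obs k n M w w' : (n <= (2 * M).+1)%N ->
  agree_obs k M w w' -> ybox X xib xih k n M w = ybox X xib xih k n M w'.
Proof.
move=> nM H; apply/ffunP => e; rewrite !ffunE.
have sM (c : 'I_n) : (absz (site M c) <= M)%N.
  by rewrite /site; have := ltn_ord c; lia.
by case: e => -[j c]; have [] := H (j : nat).+1%:Z (site M c) _ (sM c);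
  have := ltn_ord j; lia.
Qed.

Lemma sigma_obs_ybneg k (j v : int) : 1 <= j <= k%:Z ->
  <<s obs_events X xib xih k >> [set w | ybneg X xib j v w] /\
  <<s obs_events X xib xih k >> [set w | yhneg X xih j v w].
Proof.
move=> jk; split; apply: sub_sigma_algebra; [left|right];
  exists (j, v) => //; exists [set -1]; rewrite ?setTI;
  by [exact: measurable_set1|apply/seteqP; split => w /= /eqP].
Qed.

Lemma sigma_init_xneg v : <<s init_events X >> [set w | xneg X 0 v w].
Proof.
apply: sub_sigma_algebra; exists (0, v) => //; exists [set -1].
  exact: measurable_set1.
by rewrite setTI; apply/seteqP; split => w /= /eqP.
Qed.

Lemma local_obs_sigma k : local_obs k `<=` <<s obs_events X xib xih k >>.
Proof.
move=> C [M CM].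
pose z (i : ('I_k * 'I_(2 * M).+1) + ('I_k * 'I_(2 * M).+1)) (w : T) :=
  match i with
  | inl (j, c) => ybneg X xib (j : nat).+1%:Z (site M c) w
  | inr (j, c) => yhneg X xih (j : nat).+1%:Z (site M c) w
  end.
apply: (@measurable_determined _ (g_sigma_algebraType (obs_events X xib xih k))
  _ z).
  have jk (j : 'I_k) : 1 <= (j : nat).+1%:Z <= k%:Z by have := ltn_ord j; lia.
  by move=> [[j c]|[j c]]; [exact: (sigma_obs_ybneg _ (jk j)).1
    |exact: (sigma_obs_ybneg _ (jk j)).2].
move=> w w' zz; apply: CM; apply: (@agree_obs_box k (2 * M).+1) => //.
by apply/ffunP => -[[j c]|[j c]]; rewrite !ffunE; [exact: (zz (inl (j, c)))|
  exact: (zz (inr (j, c)))].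
Qed.

Lemma local_init_obs_sigma k :
  local_init_obs k `<=` <<s init_events X `|` obs_events X xib xih k >>.
Proof.
move=> C [M CM].
pose z (i : 'I_(2 * M).+1 +
    (('I_k * 'I_(2 * M).+1) + ('I_k * 'I_(2 * M).+1))) (w : T) :=
  match i with
  | inl c => xneg X 0 (site M c) w
  | inr (inl (j, c)) => ybneg X xib (j : nat).+1%:Z (site M c) w
  | inr (inr (j, c)) => yhneg X xih (j : nat).+1%:Z (site M c) w
  end.
apply: (@measurable_determined _
  (g_sigma_algebraType (init_events X `|` obs_events X xib xih k)) _ z).
  have jk (j : 'I_k) : 1 <= (j : nat).+1%:Z <= k%:Z by have := ltn_ord j; lia.
  have subX : <<s init_events X >> `<=`
      <<s init_events X `|` obs_events X xib xih k >>.
    by apply: sub_smallest2r => //; exact: subsetUl.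
  have subY : <<s obs_events X xib xih k >> `<=`
      <<s init_events X `|` obs_events X xib xih k >>.
    by apply: sub_smallest2r => //; exact: subsetUr.
  move=> [c|[[j c]|[j c]]].
  - exact: (subX _ (sigma_init_xneg _)).
  - exact: (subY _ (sigma_obs_ybneg _ (jk j)).1).
  - exact: (subY _ (sigma_obs_ybneg _ (jk j)).2).
move=> w w' zz; apply: CM.
  move=> v vM; have [sv vn] := site_absz vM.
  by have := zz (inl (Ordinal vn)); rewrite /z /= sv.
apply: (@agree_obs_box k (2 * M).+1) => //.
by apply/ffunP => -[[j c]|[j c]]; rewrite !ffunE;
  [exact: (zz (inr (inl (j, c))))|exact: (zz (inr (inr (j, c))))].
Qed.

Lemma sign_inj (a b : R) : (a = 1 \/ a = -1) -> (b = 1 \/ b = -1) ->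
  (a == -1) = (b == -1) -> a = b.
Proof. by move=> [->|->] [->|->] //; rewrite eqxx sign_neq. Qed.

Lemma sign_mul (a b : R) : (a = 1 \/ a = -1) -> (b = 1 \/ b = -1) ->
  (a * b = 1 \/ a * b = -1).
Proof.
by move=> [->|->] [->|->]; rewrite ?mulrNN ?mulr1 ?mul1r; [left|right|right|left].
Qed.

Lemma Ybar_sign i w : Ybar X xib i w = 1 \/ Ybar X xib i w = -1.
Proof.
apply: sign_mul; last exact: (noise_sign model (inl i)).
by apply: sign_mul; exact: (signal_sign model).
Qed.

Lemma Yhat_sign i w : Yhat X xih i w = 1 \/ Yhat X xih i w = -1.
Proof.
apply: sign_mul; last exact: (noise_sign model (inr i)).
by apply: sign_mul; exact: (signal_sign model).
Qed.

Lemma obs_events_local k : obs_events X xib xih k `<=` local_obs k.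
Proof.
move=> C [|] [[j v] /= jk [B mB <-]]; exists (absz v) => w w' ww;
  have [eb eh] := ww j v jk (leqnn _); rewrite !setTI /=.
- by rewrite (sign_inj (Ybar_sign (j, v) w) (Ybar_sign (j, v) w') eb).
- by rewrite (sign_inj (Yhat_sign (j, v) w) (Yhat_sign (j, v) w') eh).
Qed.

Lemma init_obs_events_local k :
  init_events X `|` obs_events X xib xih k `<=` local_init_obs k.
Proof.
move=> C [|/obs_events_local[M CM]]; last by exists M => w w' _; exact: CM.
move=> [[j v] /= -> [B mB <-]]; exists (absz v) => w w' ww _.
rewrite !setTI /= /signal /=.
by rewrite (sign_inj (signal_sign model 0 v w) (signal_sign model 0 v w')
  (ww v (leqnn _))).
Qed.

Lemma init_obs_measurable k :
  <<s init_events X `|` obs_events X xib xih k >> `<=` measurable.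
Proof.
apply: smallest_sub; first exact: sigma_algebra_measurable.
have mS : init_events X `<=` measurable.
  move=> _ [[j v] /= _ [B mB <-]]; rewrite setTI.
  exact: (measurable_funPTI (X j v)).
move=> C [/mS//|[|]] [[j v] /= _ [B mB <-]]; rewrite setTI.
- suff : measurable_fun setT (Ybar X xib (j, v)).
    by move=> /(_ measurableT B mB); rewrite setTI.
  by apply: measurable_funM => //; exact: measurable_funM.
- suff : measurable_fun setT (Yhat X xih (j, v)).
    by move=> /(_ measurableT B mB); rewrite setTI.
  by apply: measurable_funM => //; exact: measurable_funM.
Qed.

Lemma obs_sub_init_obs k : <<s obs_events X xib xih k >> `<=`
  <<s init_events X `|` obs_events X xib xih k >>.
Proof. by apply: sub_smallest2r => //; exact: subsetUr. Qed.

Lemma obs_measurable k : <<s obs_events X xib xih k >> `<=` measurable.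
Proof. by move=> B /obs_sub_init_obs; exact: init_obs_measurable. Qed.

Lemma approx_local (G : set (set T)) (L : set (set T)) :
  G `<=` L -> L `<=` measurable -> L set0 -> (forall C, L C -> L (~` C)) ->
  (forall C C', L C -> L C' -> L (C `|` C')) ->
  forall B, <<s G >> B -> forall e, 0 < e -> exists2 C, L C & pr P (B `+` C) <= e.
Proof.
move=> GL Lm L0 LC LU B GB e e0.
have LB : <<s L >> B by apply: sub_smallest2r GB.
have [_ H] := @approx_g_sigma_algebra _ T R P T unit tt (fun _ w => w) setT L
  (fun _ _ => I) (fun C LC _ => Lm C LC) (fun _ _ _ _ => erefl) L0 LC LU B LB.
by have [C LC' HC] := H e e0; exists C => //; exact: (HC tt).
Qed.

Lemma approx_obs k B : <<s obs_events X xib xih k >> B ->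
  forall e, 0 < e -> exists2 C, local_obs k C & pr P (B `+` C) <= e.
Proof.
apply: approx_local.
- exact: obs_events_local.
- by move=> C /local_obs_sigma /obs_measurable.
- by exists 0%N.
- move=> C [M CM]; exists M => w w' ww /= Cw Cw'; apply: Cw.
  by apply: CM Cw'; exact: agree_obs_sym.
- move=> C C' [M CM] [M' CM']; exists (maxn M M') => w w' ww [Cw|Cw].
    by left; apply: CM Cw; apply: agree_obs_le ww; exact: leq_maxl.
  by right; apply: CM' Cw; apply: agree_obs_le ww; exact: leq_maxr.
Qed.

Lemma approx_init_obs k B : <<s init_events X `|` obs_events X xib xih k >> B ->
  forall e, 0 < e -> exists2 C, local_init_obs k C & pr P (B `+` C) <= e.
Proof.
apply: approx_local.
- exact: init_obs_events_local.
- by move=> C /local_init_obs_sigma /init_obs_measurable.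
- by exists 0%N.
- move=> C [M CM]; exists M => w w' ww yy /= Cw Cw'; apply: Cw.
  by apply: CM Cw'; [exact: agree_init_sym|exact: agree_obs_sym].
- move=> C C' [M CM] [M' CM']; exists (maxn M M') => w w' ww yy [Cw|Cw].
    left; apply: CM Cw; first by apply: agree_init_le ww; exact: leq_maxl.
    by apply: agree_obs_le yy; exact: leq_maxl.
  right; apply: CM' Cw; first by apply: agree_init_le ww; exact: leq_maxr.
  by apply: agree_obs_le yy; exact: leq_maxr.
Qed.

End Windows.

(** * Stability for strong noise *)

Section Stability.
Context d (T : measurableType d) (R : realType) (P : probability T R) (p : R).
Variables (X xib xih : int -> int -> {RV P >-> R}).
Hypothesis model : filter_model p X xib xih.

Definition config (k : nat) (w : T) : int -> R := fun v => X k%:Z v w.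

Definition window_event (m : nat) (C : set (int -> R)) := forall x x',
  sign_configs x -> sign_configs x' ->
  (forall v : int, (absz v <= m)%N -> x v = x' v) -> C x -> C x'.

Definition local_config : set (set (int -> R)) :=
  [set C | exists m, window_event m C].

Lemma config_sign k w : @sign_configs R (config k w).
Proof. by move=> v; exact: (signal_sign model). Qed.

Lemma sign_expr_neg (r : R) : r = 1 \/ r = -1 -> (-1) ^+ (r == -1) = r.
Proof. by move=> [->|->]; rewrite ?sign_neq ?eqxx ?expr0 ?expr1. Qed.

Lemma signr_sign (b : bool) : (-1) ^+ b = 1 :> R \/ (-1) ^+ b = -1 :> R.
Proof. by case: b; rewrite ?expr1 ?expr0; [right|left]. Qed.

Lemma window_event_iff m C x x' : window_event m C ->
  sign_configs x -> sign_configs x' ->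
  (forall v : int, (absz v <= m)%N -> x v = x' v) -> C x <-> C x'.
Proof.
by move=> Cm sx sx' xx'; split; apply: Cm => // v vm; rewrite xx'.
Qed.

Lemma measurable_local_config k C : local_config C ->
  measurable (config k @^-1` C).
Proof.
move=> [m Cm]; apply: (@measurable_determined _ _ 'I_(2 * m).+1
  (fun c w => xneg X k%:Z (site m c) w)).
  by move=> c; exact: measurable_xneg.
move=> w w' zz /=; apply: Cm; [exact: config_sign..|].
move=> v vm; have [sv vn] := site_absz vm.
apply: sign_inj; [exact: config_sign..|].
by have := zz (Ordinal vn); rewrite /= sv.
Qed.

(** Every row of the signal is uniform on sign patterns. This invariance in time is what lets one
    window event approximate A at all times simultaneously. *)
Lemma pr_local_config k k' C : local_config C ->
  pr P (config k @^-1` C) = pr P (config k' @^-1` C).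
Proof.
move=> [m Cm].
pose row (k : nat) (w : T) : {ffun 'I_(2 * m).+1 -> bool} :=
  [ffun c : 'I_(2 * m).+1 => xneg X k%:Z (site m c) w].
pose ext (z : {ffun 'I_(2 * m).+1 -> bool}) (v : int) : R :=
  (-1) ^+ (z (inord (absz (v + m%:Z)))).
pose chi z := `[< C (ext z) >].
have rowE k0 z : [set w | row k0 w = z] = [set w |
    (forall c, xneg X k0%:Z (site m (c : 'I_(2 * m).+1)) w = z c) /\
    (forall j : void, nneg xib xih (match j with end) w = match j with end)].
  apply/seteqP; split => w /=.
    by move=> <-; split => [c|[]]; rewrite ffunE.
  by move=> [H _]; apply/ffunP => c; rewrite ffunE H.
suff E k0 : pr P (config k0 @^-1` C) =
    \sum_(z | chi z) (1 / 2) ^+ #|'I_(2 * m).+1| by rewrite !E.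
have -> : config k0 @^-1` C = [set w | chi (row k0 w)].
  apply/seteqP; suff H w : C (config k0 w) <-> C (ext (row k0 w)).
    by split => w /=; [move=> /H ?; exact/asboolP|move=> /asboolP /H].
  apply: (window_event_iff Cm); first exact: config_sign.
    by move=> v; exact: signr_sign.
  move=> v vm; have [sv vn] := site_absz vm.
  by rewrite /ext ffunE inordK// sv sign_expr_neg//; exact: config_sign.
rewrite pr_sum_fibers => [|z].
  apply: eq_bigr => z _; rewrite rowE.
  rewrite (@finite_law _ _ _ _ _ _ _ _ model 'I_(2 * m).+1 void
    (fun c => (k0%:Z, site m c)) (fun j => match j with end) z
    (fun j => match j with end)).
  - by rewrite big_pred0 ?mulr1//; case.
  - by move=> c c' [/addIr [cc]]; exact: val_inj.
  - by case.
apply: (@measurable_determined _ _ 'I_(2 * m).+1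
  (fun c w => xneg X k0%:Z (site m c) w)).
  by move=> c; exact: measurable_xneg.
move=> w w' zz /= <-; apply/ffunP => c; rewrite !ffunE.
by rewrite (zz c).
Qed.

Lemma approx_config A e : measurable_config A -> 0 < e ->
  exists m C, window_event m C /\
    forall k, measurable (config k @^-1` A) /\
              pr P (config k @^-1` (A `+` C)) <= e.
Proof.
move=> mA e0.
have LA : <<s @sign_configs R, local_config >> A.
  apply: sub_smallest2r mA; first by apply: smallest_sigma_algebra.
  move=> _ [v [s ->]]; exists (absz v) => x x' _ sx' xx' [_ /= xv].
  by split => //=; rewrite -xx'.
have L0 : local_config set0 by exists 0%N.
have LC C : local_config C -> local_config (~` C).
  move=> [m Cm]; exists m => x x' sx sx' xx' /= nCx Cx'; apply: nCx.
  by apply: Cm Cx' => // v vm; rewrite xx'.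
have LU C C' : local_config C -> local_config C' -> local_config (C `|` C').
  move=> [m Cm] [m' Cm']; exists (maxn m m') => x x' sx sx' xx' [Cx|Cx].
    by left; apply: Cm Cx => // v vm; rewrite xx'// (leq_trans vm)// leq_maxl.
  by right; apply: Cm' Cx => // v vm; rewrite xx'// (leq_trans vm)// leq_maxr.
have [mA' aA] := @approx_g_sigma_algebra _ T R P _ nat 0%N config
  (@sign_configs R) local_config config_sign
  (fun C LC k => measurable_local_config k LC)
  (fun C LC k k' => pr_local_config k k' LC) L0 LC LU A LA.
have [C [m Cm] HC] := aA e e0.
by exists m, C; split; [exact: Cm|move=> k; split; [exact: mA'|exact: HC]].
Qed.

Hypothesis p_gt : 49 / 100 < p.
Hypothesis p_le : p <= 1 / 2.

Section BoxEstimate.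
Variables (k m M : nat) (C : set (int -> R)).
Hypotheses (Cm : window_event m C) (mM : (m <= M)%N).
Notation n := (2 * M).+1.
Notation V := ('I_k.+1 * 'I_n.+1)%type.
Notation E := (('I_k * 'I_n) + ('I_k * 'I_n))%type.

Let xb := xbox X k n M.
Let yb := ybox X xib xih k n M.

(** The value 1 outside the window completes the row at time k to a sign configuration on which [C]
    can be tested. *)
Definition box_config (x : {ffun V -> bool}) (v : int) : R :=
  if (absz v <= m)%N then (-1) ^+ (x (ord_max, inord (absz (v + M%:Z)%R))) else 1.

Definition box_cond_prob (y : {ffun E -> bool}) : R :=
  pr P [set w | yb w = y /\ C (config k w)] / pr P [set w | yb w = y].

(** The conditional probability of [C] at time k given the observations at the sites |v| <= M, in
    closed form. As a finite sum of indicators it is integrated term by term. *)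
Definition box_filter (w : T) : R :=
  \sum_(y : {ffun E -> bool}) box_cond_prob y * \1_[set w | yb w = y] w.

Lemma box_filterE w : box_filter w = box_cond_prob (yb w).
Proof.
rewrite /box_filter (bigD1 (yb w))//= big1 ?addr0 => [|y yw].
  by rewrite indicE mem_set// mulr1.
by rewrite indicE memNset ?mulr0//= => /esym/eqP; rewrite (negbTE yw).
Qed.

Lemma box_configP w : C (config k w) <-> C (box_config (xb w)).
Proof.
apply: (window_event_iff Cm); first exact: config_sign.
  by move=> v; rewrite /box_config; case: ifP => _; [exact: signr_sign|left].
move=> v vm; rewrite /box_config vm.
have [sv vn] := site_absz (leq_trans vm mM).
rewrite ffunE /= inordK ?sv; first by rewrite sign_expr_neg//; exact: config_sign.
exact: leq_trans vn _.
Qed.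

Lemma measurable_ybox y : measurable [set w | yb w = y].
Proof.
have -> : [set w | yb w = y] = \bigcup_(x in [set: {ffun V -> bool}])
    [set w | xb w = x /\ yb w = y].
  by apply/seteqP; split => w /=; [move=> <-; exists (xb w)|move=> [x _ []]].
apply: fin_bigcup_measurable => [|x _]; first exact: finite_finset.
exact: (measurable_box model).
Qed.

Let S := [pred c : 'I_n.+1 | (absz (site M c) <= m)%N].

Lemma card_window : (#|S| <= (2 * m).+1)%N.
Proof.
rewrite cardE -(size_map val) -[leqRHS](size_iota (M - m)).
apply: uniq_leq_size; first by rewrite (map_inj_uniq val_inj) enum_uniq.
move=> _ /mapP[c + ->]; rewrite mem_enum inE mem_iota /site /=; lia.
Qed.

(** For fixed observations y, an event D of the window turns into a condition on row 0 of the
    configuration, that is, into a boundary event for the Gibbs law. *)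
Definition compatible (D : set T) (y : {ffun E -> bool}) (x : {ffun V -> bool}) :=
  `[< exists w, [/\ D w, yb w = y & forall c, xb w (ord0, c) = x (ord0, c)] >].

Lemma compatibleP D y w :
  (forall w w', agree_init X M w w' -> agree_obs X xib xih k M w w' ->
    D w -> D w') ->
  yb w = y -> compatible D y (xb w) <-> D w.
Proof.
move=> Dloc yw; split=> [/asboolP[w' [Dw' yw' xw']]|Dw]; last first.
  by apply/asboolP; exists w.
apply: Dloc Dw'; first exact: (agree_init_box (leqnSn _) xw').
by apply: (@agree_obs_box _ _ _ _ _ _ _ k n) => //; rewrite -/yb yw yw'.
Qed.

Lemma compatible_bd D y : bd_event (@initial_site k n) (compatible D y).
Proof.
move=> v x v0; have vE c : (ord0, c) == v = false.
  by apply: contraNF v0 => /eqP <-; rewrite /initial_site.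
have fE c : flip v x (ord0, c) = x (ord0, c) by rewrite ffunE vE addbF.
by congr asbool; apply/propext; split=> -[w [Dw yw xw]]; exists w; split=> // c;
  have := xw c; rewrite fE.
Qed.

(** [box_filter] ignores X_0 and yet nearly satisfies the defining identity of the filter that knows
    X_0, on all window events D. On each fibre of the observations this is [gibbs_decay] between
    [compatible D y] and the sure event. *)
Lemma box_filter_Rintegral D : measurable D ->
  (forall w w', agree_init X M w w' -> agree_obs X xib xih k M w w' ->
    D w -> D w') ->
  `|\int[P]_(w in D) box_filter w - pr P (config k @^-1` C `&` D)| <=
  (2 * m).+1%:R / 2 ^+ k.
Proof.
move=> mD Dloc.
rewrite Rintegral_indic_sum//; last exact: measurable_ybox.
have mC : measurable (config k @^-1` C) by apply: measurable_local_config; exists m.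
have split_y F := @pr_split_fibers _ _ _ P _ yb F measurable_ybox.
have mCD : measurable (config k @^-1` C `&` D) by exact: measurableI.
rewrite (split_y _ mCD) -sumrB.
apply: (@le_trans _ _ (\sum_(y : {ffun E -> bool})
    (2 * m).+1%:R / 2 ^+ k * pr P ([set w | yb w = y] `&` D))); last first.
  by rewrite -mulr_sumr -split_y// ler_piMr ?pr_le1//.
apply: (le_trans (ler_norm_sum _ _ _)); apply: ler_sum => y _.
pose K : R := (1 / 2) ^+ #|{: V}|.
have K0 : 0 < K by rewrite exprn_gt0.
pose f (x : {ffun V -> bool}) : R := (`[< C (box_config x) >])%:R.
pose Q := compatible D y.
pose W := gibbs p y.
have W0 x : 0 < W x by exact: gibbs_gt0.
have law (chi : pred {ffun V -> bool}) (F : set T) :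
    (forall w, yb w = y -> chi (xb w) <-> F w) ->
    pr P ([set w | yb w = y] `&` F) = K * \sum_(x | chi x) W x.
  move=> HF; rewrite /K /W -(box_law model M); congr (pr P).
  by apply/seteqP; split => w /= [yw] /(HF _ yw).
have sumf Q' : \sum_(x | Q' x && `[< C (box_config x) >]) W x =
    \sum_(x | Q' x) W x * f x.
  rewrite [RHS]big_mkcond [LHS]big_mkcond; apply: eq_bigr => x _; rewrite /f.
  by case: (Q' x); case: `[< _ >] => /=; rewrite ?mulr1 ?mulr0.
have E1 : pr P [set w | yb w = y] = K * \sum_(x | xpredT x) W x.
  by rewrite -[X in pr P X]setIT; apply: law.
have E2 : pr P ([set w | yb w = y] `&` D) = K * \sum_(x | Q x) W x.
  by apply: law => w yw; exact: compatibleP.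
have E3 : pr P [set w | yb w = y /\ C (config k w)] =
    K * \sum_(x | xpredT x) W x * f x.
  rewrite -sumf; apply: law => w yw /=.
  by rewrite box_configP; split => [/asboolP|/asboolP].
have E4 : pr P ([set w | yb w = y] `&` (config k @^-1` C `&` D)) =
    K * \sum_(x | Q x) W x * f x.
  rewrite -sumf; apply: law => w yw; rewrite /= box_configP.
  split=> [/andP[/(compatibleP Dloc yw) ? /asboolP]|[Cw Dw]] //.
  by apply/andP; split; [exact/(compatibleP Dloc yw)|exact/asboolP].
rewrite /box_cond_prob E1 E2 E3 E4.
have f01 x : 0 <= f x <= 1 by rewrite /f; case: `[< _ >]; rewrite /= ?lexx ?ler01.
have fS (x x' : {ffun V -> bool}) :
    (forall c, c \in S -> x (ord_max, c) = x' (ord_max, c)) -> f x = f x'.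
  move=> xx'; rewrite /f; congr (nat_of_bool (asbool (C _)))%:R.
  apply/funext => v; rewrite /box_config; case: ifP => // vm.
  have [sv vn] := site_absz (leq_trans vm mM).
  by rewrite xx'// inE /= inordK ?sv// (leq_trans vn).
have bdT : bd_event (@initial_site k n) xpredT by [].
have := @gibbs_decay R p k n p_gt p_le y S f Q xpredT f01 fS
  (@compatible_bd D y) bdT.
rewrite -/W -/Q.
set qD := \sum_(x | Q x) W x * f x; set ZD := \sum_(x | Q x) W x.
set q := \sum_(x | xpredT x) W x * f x; set Z := \sum_(x | xpredT x) W x.
have Z0 : 0 < Z.
  rewrite /Z (bigD1 [ffun => false])//= ltr_pwDl// sumr_ge0// => x _.
  exact: ltW.
have ZD0 : 0 <= ZD by apply: sumr_ge0 => x _; exact: ltW.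
move=> H; have -> : K * q / (K * Z) * (K * ZD) - K * qD =
    - (K / Z) * (qD * Z - ZD * q).
  by field; rewrite !gt_eqF.
rewrite normrM normrN (@ger0_norm _ (K / Z)) ?divr_ge0 ?(ltW K0) ?(ltW Z0)//.
apply: (@le_trans _ _ (K / Z * (#|S|%:R / 2 ^+ k * (ZD * Z)))).
  by rewrite ler_wpM2l ?divr_ge0 ?(ltW K0) ?(ltW Z0).
have -> : K / Z * (#|S|%:R / 2 ^+ k * (ZD * Z)) = #|S|%:R / 2 ^+ k * (K * ZD).
  by field; rewrite !gt_eqF ?exprn_gt0.
rewrite ler_wpM2r ?mulr_ge0 ?(ltW K0)// ler_wpM2r ?invr_ge0 ?exprn_ge0//.
by rewrite ler_nat card_window.
Qed.

End BoxEstimate.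

End Stability.

(** * Comparison of the two filters *)

Section StabilityAssembly.
Context d (T : measurableType d) (R : realType) (P : probability T R) (p : R).
Variables (X xib xih : int -> int -> {RV P >-> R}).
Hypothesis model : filter_model p X xib xih.

Lemma local_init_obs_common k n (C : nat -> set T) :
  (forall i, local_init_obs X xib xih k (C i)) ->
  exists M, forall i w w', (i < n)%N -> agree_init X M w w' ->
    agree_obs X xib xih k M w w' -> C i w <-> C i w'.
Proof.
move=> /choice[Mi HM]; exists (\max_(i < n) Mi i) => i w w' i_n ww yy.
have iM : (Mi i <= \max_(i < n) Mi i)%N.
  exact: (@leq_bigmax _ (fun i : 'I_n => Mi i) (Ordinal i_n)).
have ww' := agree_init_le iM ww; have yy' := agree_obs_le iM yy.
by split; apply: HM => //; [exact: agree_init_sym|exact: agree_obs_sym].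
Qed.

Hypothesis p_gt : 49 / 100 < p.
Hypothesis p_le : p <= 1 / 2.

(** The window M depends on the step function [u] approximating f; this does no harm because
    [box_filter_Rintegral] is uniform in M. Of 8 delta, one half comes from f versus [u] and the
    other from A versus [C]. *)
Lemma filter_dist_le (A C : set (int -> R)) m k delta (f g : T -> R) :
  0 < delta -> measurable (config X k @^-1` A) -> window_event m C ->
  pr P (config X k @^-1` (A `+` C)) <= delta ->
  is_cond_prob P <<s init_events X `|` obs_events X xib xih k >>
    (config X k @^-1` A) f ->
  is_cond_prob P <<s obs_events X xib xih k >> (config X k @^-1` A) g ->
  \int[P]_(w in setT) `|f w - g w| <=
    8 * delta + 4 * ((2 * m).+1%:R / 2 ^+ k).
Proof.
move=> d0 mA Cm AC cf cg.
have mG := @init_obs_measurable _ _ _ P X xib xih k.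
have [N [Cs [locCs uf]]] := cond_prob_approx mA mG cf
  (fun C LC => mG _ (local_init_obs_sigma LC))
  (fun B GB e e0 => approx_init_obs model GB e0) d0.
have [M0 HM0] := local_init_obs_common N.+1 locCs.
pose M := maxn m M0; have mM : (m <= M)%N by exact: leq_maxl.
have HM i w w' : (i < N.+1)%N -> agree_init X M w w' ->
    agree_obs X xib xih k M w w' -> Cs i w <-> Cs i w'.
  move=> iN ww yy; apply: HM0 => //.
    by apply: agree_init_le ww; exact: leq_maxr.
  by apply: agree_obs_le yy; exact: leq_maxr.
pose u w : R := \sum_(i < N.+1) N.+1%:R^-1 * \1_(Cs i) w.
pose h := box_filter X xib xih k M C.
have mCs i : measurable (Cs i) by exact: mG _ (local_init_obs_sigma (locCs i)).
have mC : measurable (config X k @^-1` C).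
  by apply: (measurable_local_config model); exists m.
have Iu : P.-integrable setT (EFin \o u) by exact: integrable_indic_sum.
have Ih : P.-integrable setT (EFin \o h).
  by apply: integrable_indic_sum => y; exact: (measurable_ybox model).
have yloc w w' : agree_obs X xib xih k M w w' ->
    ybox X xib xih k (2 * M).+1 M w = ybox X xib xih k (2 * M).+1 M w'.
  exact: box_agree_obs.
have hE w w' : agree_obs X xib xih k M w w' -> h w = h w'.
  by move=> yy; rewrite /h !box_filterE (yloc _ _ yy).
have uE w w' : agree_init X M w w' -> agree_obs X xib xih k M w w' -> u w = u w'.
  move=> ww yy; apply: eq_bigr => i _; rewrite !indicE.
  congr (_ * (nat_of_bool _)%:R); have [H1 H2] := HM i w w' (ltn_ord i) ww yy.
  by apply/idP/idP; rewrite !inE.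
pose e := (2 * m).+1%:R / 2 ^+ k + delta.
have H1 : let B := [set w | h w <= g w] in
    <<s obs_events X xib xih k >> B /\ <<s obs_events X xib xih k >> (~` B).
  move=> B; suff HB : <<s obs_events X xib xih k >> B.
    by split=> //; exact: (@measurableC _ (g_sigma_algebraType _) _ HB).
  pose c := @box_cond_prob _ _ _ P X xib xih k M C.
  (* [h] has finitely many values, each taken on local events, so B is a finite union of local
     events intersected with level sets of g. *)
  have -> : B = \bigcup_(y in [set: _])
     ([set w | ybox X xib xih k (2 * M).+1 M w = y] `&` g @^-1` `[c y, +oo[%classic).
    apply/seteqP; split => w; rewrite /B /= /h box_filterE.
      by move=> cg'; exists (ybox X xib xih k (2 * M).+1 M w) => //; split => //=;
        rewrite in_itv/= andbT.
    by move=> [y _ [/= <-]]; rewrite in_itv/= andbT.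
  apply: (@fin_bigcup_measurable _ (g_sigma_algebraType _)).
    exact: finite_finset.
  move=> y _; apply: (@measurableI _ (g_sigma_algebraType _)).
    by apply: local_obs_sigma; exists M => w w' /yloc /= ->.
  by have [Hg _ _] := cg; exact: Hg.
have H2 : let B := [set w | u w <= h w] in
  [/\ <<s init_events X `|` obs_events X xib xih k >> B,
    <<s init_events X `|` obs_events X xib xih k >> (~` B),
    `|\int[P]_(w in B) h w - pr P (config X k @^-1` A `&` B)| <= e &
    `|\int[P]_(w in ~` B) h w - pr P (config X k @^-1` A `&` ~` B)| <= e].
  move=> B.
  have locB w w' : agree_init X M w w' -> agree_obs X xib xih k M w w' ->
      B w -> B w'.
    by move=> ww yy; rewrite /B /= (hE _ _ yy) (uE _ _ ww yy).
  have locB' w w' : agree_init X M w w' -> agree_obs X xib xih k M w w' ->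
      (~` B) w -> (~` B) w'.
    by move=> ww yy; rewrite /B /= (hE _ _ yy) (uE _ _ ww yy).
  have key D : measurable D ->
      (forall w w', agree_init X M w w' -> agree_obs X xib xih k M w w' ->
        D w -> D w') ->
      `|\int[P]_(w in D) h w - pr P (config X k @^-1` A `&` D)| <= e.
    move=> mD locD.
    have K1 := box_filter_Rintegral model p_gt p_le Cm mM mD locD.
    have mCD : measurable (config X k @^-1` C `&` D) by exact: measurableI.
    have mAD : measurable (config X k @^-1` A `&` D) by exact: measurableI.
    have K2 := pr_setY_ge P mCD mAD.
    have K3 : pr P ((config X k @^-1` C `&` D) `+` (config X k @^-1` A `&` D))
        <= delta.
      apply: le_trans AC; apply: le_pr; first exact: measurable_setY.
        exact: (measurable_setY mA mC).
      by move=> w [[[Cw Dw] nAD]|[[Aw Dw] nCD]]; [right|left]; split => // ?;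
        [apply: nAD|apply: nCD].
    rewrite -(subrKA (pr P (config X k @^-1` C `&` D))).
    apply: (le_trans (ler_normD _ _)); apply: lerD => //.
    exact: le_trans K2 K3.
  have GB := local_init_obs_sigma (ex_intro _ M locB : local_init_obs X xib xih k B).
  have GB' := local_init_obs_sigma
    (ex_intro _ M locB' : local_init_obs X xib xih k (~` B)).
  by split => //; apply: key => //; exact: mG.
have := Rintegral_cond_prob_dist mG (@obs_sub_init_obs _ _ _ P X xib xih k)
  cf cg Ih Iu H1 H2.
by rewrite /e /u => H; move: uf H; set a := \int[P]_(w in _) _; lra.
Qed.

Lemma high_noise_stable : filter_stable X xib xih.
Proof.
move=> A mA f g Xk cf cg.
have If k := cond_prob_integrable (cf k); have Ig k := cond_prob_integrable (cg k).
have -> : (fun k => 'E_P[(fun w => `|f k w - g k w|)%R]%E) =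
    EFin \o (fun k => \int[P]_(w in setT) `|f k w - g k w|).
  apply/funext => k /=; rewrite unlock /Rintegral fineK//.
  apply: integrable_fin_num => //; exact: integrable_dist.
apply: cvg_EFin; first by near=> k.
apply/cvgrPdist_le => e e0.
(* 8 * (e / 16) is e / 2; the term decaying like 2^-k takes the other half. *)
have d0 : 0 < e / 16 by rewrite divr_gt0.
have [m [C [Cm HC]]] := approx_config model mA d0.
have : geometric (4 * (2 * m).+1%:R) (2^-1) @ \oo --> (0 : R).
  by apply: cvg_geometric; rewrite ger0_norm ?invr_ge0//; lra.
move=> /cvgrPdist_le /(_ (e / 2)) H; near=> k.
have [mAk ACk] := HC k.
rewrite sub0r normrN ger0_norm; last by apply: Rintegral_ge0.
apply: (le_trans (filter_dist_le d0 mAk Cm ACk (cf k) (cg k))).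
suff : `|0 - geometric (4 * (2 * m).+1%:R) 2^-1 k| <= e / 2.
  rewrite sub0r normrN /geometric /= exprVn => /(le_trans (ler_norm _)).
  by rewrite -mulrA => ?; lra.
by near: k; apply: H; rewrite divr_gt0.
Unshelve. all: by end_near.
Qed.

End StabilityAssembly.

(** * Instability for weak noise *)

Section Symmetry.
Context d (T : measurableType d) (R : realType) (P : probability T R) (p : R).
Variables (X xib xih : int -> int -> {RV P >-> R}).
Hypothesis model : filter_model p X xib xih.

Let A k : set T := [set w | xneg X k%:Z 0 w = false].

Lemma measurable_plus k : measurable (A k).
Proof. exact: (measurable_pre_eq (X k%:Z 0) (-1) false). Qed.

Lemma gibbs_negate k n y (x : {ffun 'I_k.+1 * 'I_n.+1 -> bool}) :
  gibbs p y [ffun v => ~~ x v] = gibbs p y x.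
Proof.
apply: eq_bigr => e _; rewrite !ffunE; congr wgt.
by case: (y e); case: (x (src e)); case: (x (tgt e)).
Qed.

(** On each fibre of the observations, negating all sites preserves [gibbs] and exchanges the two
    values of the site at time k and position 0, which has index M in the box. *)
Lemma pr_plus_local k B : local_obs X xib xih k B ->
  pr P (A k `&` B) = pr P B / 2.
Proof.
move=> locB; have [M BM] := locB.
have mB : measurable B.
  exact: (@obs_measurable _ _ _ P X xib xih k) _ (local_obs_sigma locB).
have mA := measurable_plus k.
suff E : pr P (A k `&` B) = pr P (~` A k `&` B).
  have := pr_setDI P mB mA; rewrite setDE (setIC B (A k)) (setIC B (~` A k)) -E.
  by move=> ?; lra.
pose n := (2 * M).+1; pose yb := ybox X xib xih k n M.
pose xb := xbox X k n M.
have mn : (M < n.+1)%N by rewrite /n; lia.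
have xbE w : xb w (ord_max, Ordinal mn) = xneg X k%:Z 0 w.
  by rewrite ffunE /= /site subrr.
have my y : measurable [set w | yb w = y] by exact: (measurable_ybox model).
have mAB : measurable (A k `&` B) by exact: measurableI.
have mAB' : measurable (~` A k `&` B).
  by apply: measurableI => //; exact: measurableC.
rewrite (pr_split_fibers P my mAB) (pr_split_fibers P my mAB').
apply: eq_bigr => y _.
have [[w0 [yw0 Bw0]]|noB] := pselect (exists w, yb w = y /\ B w); last first.
  by congr (pr P); apply/seteqP; split => w /= [yw [_ Bw]]; exfalso; apply: noB;
    exists w.
have yB w : yb w = y -> B w.
  move=> yw; apply: BM Bw0; apply: (@agree_obs_box _ _ _ _ _ _ _ k n) => //.
  by rewrite -/yb yw yw0.
have -> : [set w | yb w = y] `&` (A k `&` B) =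
    [set w | yb w = y /\ (fun x : {ffun _} => ~~ x (ord_max, Ordinal mn)) (xb w)].
  apply/seteqP; split => w /=; rewrite xbE /A /=.
    by move=> [-> [->]].
  by move=> [yw /negbTE xw]; do !split => //; exact: yB.
have -> : [set w | yb w = y] `&` (~` A k `&` B) =
    [set w | yb w = y /\ (fun x : {ffun _} => x (ord_max, Ordinal mn)) (xb w)].
  apply/seteqP; split => w /=; rewrite xbE /A /=.
    by move=> [-> [+ _]]; case: (xneg _ _ _ _).
  by move=> [yw xw]; do !split => //; [rewrite xw|exact: yB].
rewrite (box_law model M y (fun x : {ffun _} => ~~ x (ord_max, Ordinal mn))).
rewrite (box_law model M y (fun x : {ffun _} => x (ord_max, Ordinal mn))).
congr (_ * _).
pose neg (x : {ffun 'I_k.+1 * 'I_n.+1 -> bool}) := [ffun v => ~~ x v].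
have negK : involutive neg by move=> x; apply/ffunP => v; rewrite !ffunE negbK.
rewrite (reindex_inj (inv_inj negK))/=; apply: eq_big => x.
  by rewrite ffunE negbK.
by move=> _; exact: gibbs_negate.
Qed.

Lemma pr_plus_obs k B : <<s obs_events X xib xih k >> B ->
  pr P (A k `&` B) = pr P B / 2.
Proof.
move=> oB; have mB := @obs_measurable _ _ _ P X xib xih k _ oB.
have mA := measurable_plus k.
apply/eqP; rewrite -subr_eq0 -normr_le0; apply/ler_addgt0Pr => e e0; rewrite add0r.
have e20 : 0 < e / 2 by rewrite divr_gt0.
have [C locC BC] := approx_obs model oB e20.
have mC := @obs_measurable _ _ _ P X xib xih k _ (local_obs_sigma locC).
have mAB : measurable (A k `&` B) by exact: measurableI.
have mAC : measurable (A k `&` C) by exact: measurableI.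
have H1 := le_trans (pr_setY_ge P mB mC) BC.
have H2 : `|pr P (A k `&` B) - pr P (A k `&` C)| <= e / 2.
  apply: (le_trans (pr_setY_ge P mAB mAC)); apply: le_trans BC.
  apply: le_pr; [exact: measurable_setY|exact: measurable_setY|].
  by move=> w [[[Aw Bw] nC]|[[Aw Cw] nB]]; [left|right]; split => // ?;
    [apply: nC|apply: nB].
rewrite (pr_plus_local locC) in H2.
move: H1 H2; rewrite !ler_norml => /andP[? ?] /andP[? ?]; apply/andP; split; lra.
Qed.

Lemma cond_prob_half k :
  is_cond_prob P <<s obs_events X xib xih k >> (A k) (cst (1 / 2)).
Proof.
have sT : <<s obs_events X xib xih k >> setT.
  exact: (@measurableT _ (g_sigma_algebraType (obs_events X xib xih k))).
split.
- move=> B _; have [Bh|Bh] := pselect (B (1 / 2)).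
    by have -> : cst (1 / 2) @^-1` B = [set: T] by apply/seteqP; split.
  have -> : cst (1 / 2) @^-1` B = @set0 T by apply/seteqP; split.
  exact: (@measurable0 _ (g_sigma_algebraType (obs_events X xib xih k))).
- exact: finite_measure_integrable_cst.
- move=> B oB; have mB := @obs_measurable _ _ _ P X xib xih k _ oB.
  have mAB : measurable (A k `&` B).
    by apply: measurableI => //; exact: measurable_plus.
  transitivity ((1 / 2)%:E * P B)%E; first exact (integral_cst P mB (1 / 2)%:E).
  rewrite (prE P mB) (prE P mAB) (pr_plus_obs oB) -EFinM.
  by congr EFin; lra.
Qed.

End Symmetry.

(** * Peierls estimate for the configuration of least cost *)

Section Estimator.
Context d (T : measurableType d) (R : realType) (P : probability T R) (p : R).
Variables (X xib xih : int -> int -> {RV P >-> R}).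
Hypothesis model : filter_model p X xib xih.
Hypothesis p_ge0 : 0 <= p.
Hypothesis p_small : p <= (1 / 128) ^+ 2.

Lemma in_bigsetU (I : eqType) (s : seq I) (i : I) (F : I -> set T) w :
  i \in s -> F i w -> (\big[setU/set0]_(j <- s) F j) w.
Proof.
elim: s => // j s IH; rewrite inE big_cons.
move=> /predU1P[<-|/IH H] Fi; [left|right] => //.
exact: H.
Qed.

Definition edge_index (e : edge) : (int * int) + (int * int) :=
  match e with
  | inl (j, c) => inl (j.+1%:Z, c%:Z)
  | inr (j, c) => inr (j.+1%:Z, c%:Z)
  end.

Lemma edge_index_inj : injective edge_index.
Proof. by move=> [[j c]|[j c]] [[j' c']|[j' c']] //= [-> ->]. Qed.

Definition noisy_half (W : seq edge) : set T :=
  [set w | (size W <= (count (fun e => nneg xib xih (edge_index e) w) W).*2)%N].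

Lemma measurable_noisy_half W : measurable (noisy_half W).
Proof.
apply: (@measurable_determined _ _ 'I_(size W)
  (fun i w => nneg xib xih (edge_index (tnth (in_tuple W) i)) w)).
  by move=> i; exact: measurable_nneg.
move=> w w' ww; rewrite /noisy_half /=; suff -> :
  count (fun e => nneg xib xih (edge_index e) w) W =
  count (fun e => nneg xib xih (edge_index e) w') W by [].
apply: eq_in_count => e eW; have /tnthP[i ->] : e \in in_tuple W := eW.
exact: (ww i).
Qed.

(* Union bound over the sets L of at least half of the edges of W: there are
   at most 2 ^ |W| of them, each entirely noisy with probability p ^ |L|. *)
Lemma pr_noisy_half W : uniq W -> pr P (noisy_half W) <= (1 / 64) ^+ size W.
Proof.
move=> uW; set s := size W.
pose F (L : {set 'I_s}) : set T := if (s <= #|L|.*2)%N then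
  [set w | forall i : {i | i \in L},
    nneg xib xih (edge_index (tnth (in_tuple W) (val i))) w] else set0.
have mF L : measurable (F L).
  rewrite /F; case: ifP => // _.
  apply: (@measurable_fintype_fiber _ _ {i | i \in L} _ xpredT) => i.
  exact: measurable_nneg.
have prF L : pr P (F L) <= (1 / 128) ^+ s.
  rewrite /F; case: ifP => [sL|_]; last by rewrite pr0 exprn_ge0.
  rewrite (pr_noise_all model (kappa := fun i : {i | i \in L} =>
    edge_index (tnth (in_tuple W) (val i)))); last first.
    have injW : injective (tnth (in_tuple W)) by apply/tuple_uniqP.
    by move=> i i' /edge_index_inj/injW/val_inj.
  rewrite card_sig; apply: (@le_trans _ _ (((1 / 128) ^+ 2) ^+ #|L|)).
    by rewrite lerXn2r ?nnegrE ?exprn_ge0.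
  rewrite -exprM mul2n ler_wiXn2l//; lra.
have sub : noisy_half W `<=` \big[setU/set0]_(L : {set 'I_s}) F L.
  move=> w; rewrite /noisy_half /= => H.
  pose N (i : 'I_s) := nneg xib xih (edge_index (tnth (in_tuple W) i)) w.
  apply: (@in_bigsetU _ _ (finset N)); first exact: mem_index_enum.
  have cardN : #|finset N| = count (fun e => nneg xib xih (edge_index e) w) W.
    rewrite -[W in RHS]/(tval (in_tuple W)) -(map_tnth_enum (in_tuple W)).
    rewrite count_map enumT cardsE cardE /enum_mem size_filter.
    by apply: eq_count => i.
  by rewrite /F cardN H /= => i; have := valP i; rewrite inE.
apply: (@le_trans _ _ (pr P (\big[setU/set0]_(L : {set 'I_s}) F L))).
  apply: le_pr => //; first exact: measurable_noisy_half.
  exact: bigsetU_measurable.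
apply: (le_trans (pr_bigsetU_le P (index_enum {set 'I_s}) mF)).
apply: (@le_trans _ _ (\sum_(L : {set 'I_s}) (1 / 128) ^+ s)).
  by apply: ler_sum => L _; exact: prF.
rewrite sumr_const -cardsT -powersetT card_powerset cardsT card_ord.
rewrite -[X in X <= _]mulr_natl natrX -exprMn.
by have -> : 2%:R * (1 / 128) = 1 / 64 :> R by lra.
Qed.


(** The configurations form an infinite set, but costs are natural numbers, so the least one is
    attained. *)
Lemma exists_min_cost k m (a : nat -> bool) (Y : edge -> bool) :
  exists z : nat -> nat -> bool, (forall c, (c <= m)%N -> z 0%N c = a c) /\
    forall t : nat -> nat -> bool, (forall c, (c <= m)%N -> t 0%N c = a c) ->
      (cost k m Y z <= cost k m Y t)%N.
Proof.
pose Q n := `[< exists z : nat -> nat -> bool,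
  (forall c, (c <= m)%N -> z 0%N c = a c) /\ cost k m Y z = n >].
have exQ : exists n, Q n.
  by exists (cost k m Y (fun _ => a)); apply/asboolP; exists (fun _ => a).
case: (ex_minnP exQ) => n /asboolP[z [za zn]] nmin; exists z; split => // t ta.
by rewrite zn; apply: nmin; apply/asboolP; exists t.
Qed.

(** Cut off outside the box, as is [obs_data]: sample points that agree in the box then give equal
    functions, and an estimator computed from these data is local. *)
Definition init_data m (w : T) (c : nat) : bool := (c <= m)%N && xneg X 0 c%:Z w.

Definition obs_data k m (w : T) (e : edge) : bool := in_box k m e &&
  match e with
  | inl (j, c) => ybneg X xib j.+1%:Z c%:Z w
  | inr (j, c) => yhneg X xih j.+1%:Z c%:Z w
  end.

(** The true signal violates exactly the noisy observations, which turns the count in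
    [noisy_crossing] into a count of noise variables. *)
Lemma obs_data_noise k m w e : in_box k m e ->
  obs_data k m w e (+) cobd (fun j c => xneg X j%:Z c%:Z w) e =
  nneg xib xih (edge_index e) w.
Proof.
rewrite /obs_data => ->; case: e => [[j c]|[j c]] /=.
  have -> : j%:Z = j.+1%:Z - 1 by lia.
  by rewrite (ybnegE model) addbA addb2K.
have -> : c.+1%:Z = c%:Z + 1 by lia.
by rewrite (yhnegE model) (addbC (xneg _ _ c%:Z _)) addbA addb2K.
Qed.

Lemma geometric_sum_le (x : R) h n : 0 <= x -> x <= 1 / 2 ->
  \sum_(h <= i < n) x ^+ i <= 2 * x ^+ h.
Proof.
move=> x0 x1; have [nh|hn] := leqP n h.
  by rewrite big_geq// mulr_ge0// exprn_ge0.
(* Subtracting 2 x^n makes the induction work: the step is x^n <= 2 x^n - 2 x^(n+1), valid for x <=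
   1/2. *)
suff : \sum_(h <= i < n) x ^+ i <= 2 * x ^+ h - 2 * x ^+ n.
  by move=> H; apply: (le_trans H); rewrite gerBl mulr_ge0// exprn_ge0.
have {hn} := ltnW hn; elim: n => [|n IH].
  by rewrite leqn0 => /eqP ->; rewrite big_geq// subrr.
rewrite leq_eqVlt => /predU1P[->|]; first by rewrite big_geq// subrr.
rewrite ltnS => hn; rewrite big_nat_recr//= exprS; have := IH hn.
have : 0 <= x ^+ n by exact: exprn_ge0.
by set s := \sum_(_ <= _ < _) _; set y := x ^+ n; set z := x ^+ h; nra.
Qed.

(** N only keeps the union finite; the probability bound is uniform in it. *)
Definition crossing_event k (N : nat) : set T :=
  \big[setU/set0]_(j <- iota 0 k) \big[setU/set0]_(n <- index_iota (k - j) N)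
    \big[setU/set0]_(W <- walks n (j, 0%N))
      (if uniq (inl (j, 0%N) :: W) then noisy_half (inl (j, 0%N) :: W) else set0).

Lemma measurable_crossing_event k N : measurable (crossing_event k N).
Proof.
do 3! apply: bigsetU_measurable => ? _.
by case: ifP => // _; exact: measurable_noisy_half.
Qed.

(** From a given crossing of column 0 there are at most 4^n walks with n further edges, and each is
    bad with probability at most (1/64)^(n+1). The sum over n >= k - j is of order (1/16)^(k - j),
    and k - j >= 1 makes the sum over j small uniformly in k. *)
Lemma pr_crossing_event k N : pr P (crossing_event k N) <= 1 / 128.
Proof.
pose F (j n : nat) W := if uniq ((inl (j, 0%N) : edge) :: W)
  then noisy_half (inl (j, 0%N) :: W) else set0.
have mF j n W : measurable (F j n W).
  by rewrite /F; case: ifP => // _; exact: measurable_noisy_half.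
have mF2 j n : measurable (\big[setU/set0]_(W <- walks n (j, 0%N)) F j n W).
  by apply: bigsetU_measurable.
have mF3 j : measurable (\big[setU/set0]_(n <- index_iota (k - j) N)
    \big[setU/set0]_(W <- walks n (j, 0%N)) F j n W).
  by apply: bigsetU_measurable.
have H2 j n : pr P (\big[setU/set0]_(W <- walks n (j, 0%N)) F j n W) <=
    1 / 64 * (1 / 16) ^+ n.
  apply: (le_trans (pr_bigsetU_le P _ (mF j n))).
  apply: (@le_trans _ _ (\sum_(W <- walks n (j, 0%N)) (1 / 64) ^+ n.+1)).
    rewrite big_seq [leRHS]big_seq; apply: ler_sum => W /size_in_walks Wn.
    rewrite /F; case: ifP => [uW|_]; last by rewrite pr0 exprn_ge0.
    by apply: (le_trans (pr_noisy_half uW)); rewrite /= Wn.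
  rewrite big_const_seq count_predT iter_addr_0 -[X in X <= _]mulr_natl.
  apply: (@le_trans _ _ ((4 ^ n)%:R * (1 / 64) ^+ n.+1)).
    by rewrite ler_wpM2r ?exprn_ge0// ler_nat size_walks.
  rewrite natrX exprS mulrCA ler_wpM2l// -exprMn.
  by have -> : 4%:R * (1 / 64) = 1 / 16 :> R by lra.
have x0 : 0 <= 1 / 16 :> R by lra.
have x1 : 1 / 16 <= 1 / 2 :> R by lra.
have H3 j : pr P (\big[setU/set0]_(n <- index_iota (k - j) N)
    \big[setU/set0]_(W <- walks n (j, 0%N)) F j n W) <=
    1 / 32 * (1 / 16) ^+ (k - j).
  apply: (le_trans (pr_bigsetU_le P _ (mF2 j))).
  apply: (@le_trans _ _ (\sum_((k - j)%N <= n < N) 1 / 64 * (1 / 16) ^+ n)).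
    by apply: ler_sum => n _; exact: H2.
  by rewrite -mulr_sumr; have := geometric_sum_le (k - j) N x0 x1; lra.
apply: (le_trans (pr_bigsetU_le P _ mF3)).
apply: (@le_trans _ _ (\sum_(j <- iota 0 k) 1 / 32 * (1 / 16) ^+ (k - j))).
  by apply: ler_sum => j _; exact: H3.
rewrite -mulr_sumr.
have -> : \sum_(j <- iota 0 k) (1 / 16) ^+ (k - j) =
    \sum_(1 <= i < k.+1) (1 / 16) ^+ i :> R.
  rewrite -[iota 0 k]/(iota 0 k) -{1}(subn0 k) -/(index_iota 0 k) big_nat_rev/=.
  rewrite big_add1/= big_nat [RHS]big_nat; apply: eq_bigr => j /andP[_ jk].
  by rewrite add0n subKn.
by have := geometric_sum_le 1 k.+1 x0 x1; rewrite expr1; lra.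
Qed.

Lemma exists_estimator k : exists2 S, local_init_obs X xib xih k S &
  pr P (S `+` [set w | xneg X k%:Z 0 w = false]) <= 1 / 128.
Proof.
(* With this width [minn (k - j) m] is k - j, and m is positive even for k = 0. *)
pose m := k.+1.
(* The minimiser is chosen as a function of the data, not of the sample point; this makes the
   estimating event local. *)
have /choice[est estP] : forall aY : (nat -> bool) * (edge -> bool),
    exists z : nat -> nat -> bool, (forall c, (c <= m)%N -> z 0%N c = aY.1 c) /\
    forall t : nat -> nat -> bool, (forall c, (c <= m)%N -> t 0%N c = aY.1 c) ->
      (cost k m aY.2 z <= cost k m aY.2 t)%N.
  by move=> aY; exact: exists_min_cost.
pose z w := est (init_data m w, obs_data k m w).
have locS : local_init_obs X xib xih k [set w | z w k 0%N = false].
  exists m => w w' ww yy /=; rewrite /z.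
  have -> : init_data m w = init_data m w'.
    apply/funext => c; rewrite /init_data; case: leqP => //= cm.
    by apply: ww.
  have -> // : obs_data k m w = obs_data k m w'.
  apply/funext => e; rewrite /obs_data; case: (boolP (in_box k m e)) => //= eb.
  case: e eb => [[j c]|[j c]] /= /andP[jk cm].
    by have [] := yy j.+1%:Z c%:Z _ cm; lia.
  by have [] := yy j.+1%:Z c%:Z _ (ltnW cm); lia.
exists [set w | z w k 0%N = false] => //.
(* The trail and its first crossing consist of distinct edges of the box, so [size W] stays below
   N. *)
pose N := size (box_edges k m).
apply: le_trans (pr_crossing_event k N); apply: le_pr.
- apply: measurable_setY; last exact: measurable_plus.
  exact: (@init_obs_measurable _ _ _ P X xib xih k) _ (local_init_obs_sigma locS).
- exact: measurable_crossing_event.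
move=> w zx; pose x j c := xneg X j%:Z c%:Z w.
have zxk : z w k 0%N != x k 0%N.
  by move: zx; rewrite /x /=; case: (z w k 0%N); case: (xneg X k%:Z 0 w) => /=;
    move=> [[]|[]].
have [za zmin] := estP (init_data m w, obs_data k m w).
have dataE c : (c <= m)%N -> init_data m w c = x 0%N c.
  by rewrite /init_data => ->.
have [] := @noisy_crossing k m (obs_data k m w) x (z w) (ltn0Sn _) _ zxk.
- by move=> c cm; rewrite /z za//; exact: dataE.
- by move=> t tx; apply: zmin => c cm; rewrite tx//; exact/esym/dataE.
move=> j [W [[jk uW Wbox] [Ww Wmin Wnoise]]].
have WN : (size W < N)%N.
  apply: (@uniq_leq_size _ (inl (j, 0%N) :: W)) => // e eW.
  by rewrite mem_box_edges (allP Wbox).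
apply: (@in_bigsetU _ _ j); first by rewrite mem_iota add0n.
apply: (@in_bigsetU _ _ (size W)).
  rewrite mem_index_iota WN andbT; apply: leq_trans Wmin.
  by rewrite leq_min leqnn /m; lia.
apply: (@in_bigsetU _ _ W) => //; rewrite uW.
have E : count (fun e => obs_data k m w e (+) cobd x e) (inl (j, 0%N) :: W) =
  count (fun e => nneg xib xih (edge_index e) w) (inl (j, 0%N) :: W).
  by apply: eq_in_count => e eW; apply: obs_data_noise; exact: (allP Wbox).
by rewrite E in Wnoise; exact: Wnoise.
Qed.

Lemma low_noise_unstable : ~ filter_stable X xib xih.
Proof.
move=> stable; pose A : set (int -> R) := @sign_configs R `&` [set x | x 0 = 1].
have mA : measurable_config A.
  by apply: sub_sigma_algebra; exists 0, 1.
pose Ak k : set T := [set w | xneg X k%:Z 0 w = false].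
have AE k : [set w | A (fun v => X k%:Z v w)] = Ak k.
  apply/seteqP; rewrite /A /Ak /xneg; split => w /=.
    by move=> [_ ->]; rewrite sign_neq.
  move=> Xw; split; first exact: (config_sign model).
  by case: (signal_sign model k%:Z 0 w) => // X1; move: Xw; rewrite X1 eqxx.
have mAk k : measurable (Ak k) by exact: measurable_plus.
have /choice[f cf] : forall k, exists f,
    is_cond_prob P <<s init_events X `|` obs_events X xib xih k >> (Ak k) f.
  move=> k; apply: is_cond_prob_exists => // B GB.
  apply: (@init_obs_measurable _ _ _ P X xib xih k).
  exact: sub_sigma_algebra.
have cf' k : is_cond_prob P <<s init_events X `|` obs_events X xib xih k >>
    [set w | A (fun v => X k%:Z v w)] (f k) by rewrite AE; exact: cf.
have cg' k : is_cond_prob P <<s obs_events X xib xih k >>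
    [set w | A (fun v => X k%:Z v w)] (cst (1 / 2)).
  by rewrite AE; exact: (cond_prob_half model).
have := stable A mA f (fun _ => cst (1 / 2)) cf' cg'.
have Ih : P.-integrable setT (EFin \o cst (1 / 2)).
  exact: finite_measure_integrable_cst.
have -> : (fun k => 'E_P[(fun w => `|f k w - cst (1 / 2) w|)%R]%E) =
    EFin \o (fun k => \int[P]_(w in setT) `|f k w - cst (1 / 2) w|).
  apply/funext => k /=; rewrite unlock /Rintegral fineK//.
  apply: integrable_fin_num => //; apply: integrable_dist => //.
  exact: cond_prob_integrable (cf k).
move=> /fine_cvgP[_ /cvgrPdist_le /(_ (1 / 16))] H.
have [K _ HK] : \forall k \near \oo,
    `|0 - \int[P]_(w in setT) `|f k w - cst (1 / 2) w| | <= 1 / 16.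
  by apply: H; lra.
have := HK K (leqnn K); rewrite /= sub0r normrN => {H HK}.
move=> /(le_trans (ler_norm _)); apply/negP; rewrite -ltNge.
have If := cond_prob_integrable (cf K).
have [S locS SA] := exists_estimator K.
have GS := local_init_obs_sigma locS.
have mS : measurable S by exact: (@init_obs_measurable _ _ _ P X xib xih K) _ GS.
have Id := integrable_dist If Ih.
(* S belongs to the conditioning sigma-algebra, so this integral is P(Ak and S) - P(S) / 2, that is,
   half of P(Ak and S) - P(S minus Ak). With errors of at most 1/128 it is at least (1/2 - 1/64) / 2
   > 1/16. *)
apply: (@lt_le_trans _ _ (\int[P]_(w in S) (f K w - cst (1 / 2) w))); last first.
  rewrite (Rintegral_setC mS Id).
  have : \int[P]_(w in S) (f K w - cst (1 / 2) w) <=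
      \int[P]_(w in S) `|f K w - cst (1 / 2) w|.
    apply: le_Rintegral_subset => //; first exact: integrable_sub.
    by move=> w _; exact: ler_norm.
  have : 0 <= \int[P]_(w in ~` S) `|f K w - cst (1 / 2) w|.
    by apply: Rintegral_ge0.
  by set i1 := Rintegral _ _ _; set i2 := Rintegral _ _ _;
    set i3 := Rintegral _ _ _ => ? ?; lra.
rewrite Rintegral_sub// (cond_prob_Rintegral (cf K) GS) Rintegral_cst//.
rewrite -/(pr P S).
have prA : pr P (Ak K) = 1 / 2.
  by rewrite /pr (signal_negb model (K%:Z, 0) false).
have := pr_setDI P (mAk K) mS; have := pr_setDI P mS (mAk K).
rewrite (setIC S) prA.
have : pr P (Ak K `\` S) <= 1 / 128.
  apply: le_trans SA; apply: le_pr; last exact: subsetUr.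
    exact: measurableD.
  exact: (measurable_setY mS (mAk K)).
have : pr P (S `\` Ak K) <= 1 / 128.
  apply: le_trans SA; apply: le_pr; last exact: subsetUl.
    exact: measurableD.
  exact: (measurable_setY mS (mAk K)).
by lra.
Qed.

End Estimator.

Theorem theorem3p1 (R : realType) :
  exists p_low p_high : R,
    [/\ 0 < p_low, p_low <= p_high, p_high < 1 / 2 &
      forall (p : R), 0 <= p <= 1 / 2 ->
      forall (d : measure_display) (T : measurableType d)
             (P : probability T R) (X xib xih : int -> int -> {RV P >-> R}),
      filter_model p X xib xih ->
        (p_high < p -> filter_stable X xib xih) /\
        (p < p_low -> ~ filter_stable X xib xih)].
Proof.
exists ((1 / 128) ^+ 2), (49 / 100); split; [lra..|].
move=> p /andP[p0 p1] d T P X xib xih model; split => [p_gt|p_lt].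
  exact: high_noise_stable model p_gt p1.
exact: low_noise_unstable model p0 (ltW p_lt).
Qed.
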